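(* There is a function $\Omega\to\mathbb{R}$, $\overline{\alpha}\mapsto \mathbf{t}_{\overline{\alpha}}$ (depending only on the type $\overline{\alpha}$, not on any polytope), such that every compact Coxeter polytope $P\subset\mathbb{H}^3$ has an edge $E$ whose associated ridge $\Sigma_E$, of type $\overline{\alpha}$, has width less than $\mathbf{t}_{\overline{\alpha}}$. Moreover, $$\max_{\overline{\alpha}\in\Omega}\mathbf{t}_{\overline{\alpha}}=\mathbf{t}_{(\pi/5,\pi/3,\pi/3,\pi/2,\pi/2)}<5.75 .$$
   Context: $\mathbb{H}^3$ is hyperbolic 3-space with metric $\rho$. A Coxeter polytope is a convex polytope (intersection of finitely many half-spaces with nonempty interior) all of whose dihedral angles are of the form $\pi/k$ with $k\ge 2$ an integer; compact ones are simple. A facet is a face of codimension 1. For an edge $E$ of a compact Coxeter polytope $P\subset\mathbb{H}^3$ with vertices $V_1,V_2$, let $F_1,F_2$ be the two facets containing $E$, and let the framing facets of $E$ be $F_3$ (the facet containing $V_1$ but not $E$) and $F_4$ (the facet containing $V_2$ but not $E$). The ridge associated with $E$ is $\Sigma_E=\{F_1,F_2,F_3,F_4\}$; its width is $\cosh\rho(F_3,F_4)$, where $\rho(F_3,F_4)$ is the distance between the facets (equal to $0$ if they meet). Its type is the tuple $\overline{\alpha}=(\alpha_{12},\alpha_{13},\alpha_{14},\alpha_{23},\alpha_{24})$, where $\alpha_{ij}$ is the dihedral angle between $F_i$ and $F_j$. $\Omega$ denotes the set of all types of ridges that occur in compact Coxeter polytopes in $\mathbb{H}^3$. *)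

(* Defs.v *)
From HB Require Import structures.
From mathcomp Require Import all_boot all_order all_algebra.
From mathcomp Require Import all_classical all_reals all_analysis.
From mathcomp Require Import Rstruct Rstruct_topology.
Set Implicit Arguments.
Unset Strict Implicit.
Unset Printing Implicit Defensive.
Import Order.TTheory GRing.Theory Num.Theory.
Import numFieldNormedType.Exports.
Local Open Scope classical_set_scope.
Local Open Scope ring_scope.

(** Ambient space: the concrete real numbers (Stdlib's R, a realType),
    points of R^{1,3} as row vectors of length 4; coordinate 0 is timelike. *)
Definition R : realType := Rdefinitions.R.
Definition vec := 'rV[R]_4.

Definition lor (u v : vec) : R :=
  \sum_(i < 4) (if i == 0 :> nat then -1 else 1) * u ord0 i * v ord0 i.

Definition H3 : set vec := [set x | lor x x = -1 /\ 0 < x ord0 ord0].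

Definition acosh (z : R) : R := ln (z + Num.sqrt (z ^+ 2 - 1)).
Definition cosh (z : R) : R := (expR z + expR (- z)) / 2.

Definition hdist (x y : vec) : R := acosh (- lor x y).

Definition halfspace (e : vec) : set vec := [set x | H3 x /\ lor x e <= 0].

Definition convex_polytope (P : set vec) : Prop :=
  (exists (n : nat) (e : 'I_n -> vec),
      (forall i, 0 < lor (e i) (e i)) /\
      P = [set x | H3 x /\ forall i, lor x (e i) <= 0]) /\
  (exists x, P x /\ exists r : R, 0 < r /\
      forall y, H3 y -> hdist x y < r -> P y).

Definition face (P F : set vec) : Prop :=
  exists e : vec, 0 < lor e e /\
    (forall x, P x -> lor x e <= 0) /\
    F = [set x | P x /\ lor x e = 0] /\ (exists x, F x).

Definition has_indep (F : set vec) (m : nat) : Prop :=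
  exists x : 'I_m -> vec, (forall i, F (x i)) /\ row_free (\matrix_(i < m) x i).

(** Dimension of a subset of H^3 = dimension of the smallest totally geodesic
    subspace containing it = (dimension of its linear span in R^4) - 1. *)
Definition hdim (F : set vec) (k : nat) : Prop :=
  has_indep F k.+1 /\ ~ has_indep F k.+2.

Definition facet (P F : set vec) : Prop := face P F /\ hdim F 2.
Definition edge (P E : set vec) : Prop := face P E /\ hdim E 1.
Definition vertex (P : set vec) (v : vec) : Prop := face P [set v].

Definition outward_normal (P F : set vec) (e : vec) : Prop :=
  lor e e = 1 /\ (forall x, P x -> lor x e <= 0) /\
  F = [set x | P x /\ lor x e = 0].

Definition dihedral (P F G : set vec) (a : R) : Prop :=
  exists e f, outward_normal P F e /\ outward_normal P G f /\
    a = acos (- lor e f).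

Definition coxeter_polytope (P : set vec) : Prop :=
  convex_polytope P /\
  forall F G, facet P F -> facet P G -> F <> G -> edge P (F `&` G) ->
    forall a, dihedral P F G a -> exists k : nat, (2 <= k)%N /\ a = pi / k%:R.

Definition compact_coxeter_polytope (P : set vec) : Prop :=
  coxeter_polytope P /\ compact P.

(** Type of a ridge: (a12, a13, a14, a23, a24). *)
Definition rtype := (R * R * R * R * R)%type.

Definition ridge (P : set vec) (E : set vec) (V1 V2 : vec)
    (F1 F2 F3 F4 : set vec) (t : rtype) : Prop :=
  edge P E /\ vertex P V1 /\ vertex P V2 /\ V1 <> V2 /\ E V1 /\ E V2 /\
  facet P F1 /\ facet P F2 /\ F1 <> F2 /\ E `<=` F1 /\ E `<=` F2 /\
  facet P F3 /\ F3 V1 /\ ~ (E `<=` F3) /\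
  facet P F4 /\ F4 V2 /\ ~ (E `<=` F4) /\
  let: (a12, a13, a14, a23, a24) := t in
  dihedral P F1 F2 a12 /\ dihedral P F1 F3 a13 /\ dihedral P F1 F4 a14 /\
  dihedral P F2 F3 a23 /\ dihedral P F2 F4 a24.

Definition set_dist (A B : set vec) : R :=
  inf [set hdist x y | x in A & y in B].
Definition width (F3 F4 : set vec) : R := cosh (set_dist F3 F4).

Definition Omega : set rtype :=
  [set t | exists P E V1 V2 F1 F2 F3 F4,
      compact_coxeter_polytope P /\ ridge P E V1 V2 F1 F2 F3 F4 t].

Definition alpha0 : rtype := (pi / 5, pi / 3, pi / 3, pi / 2, pi / 2).

(* Main.v *)
Require Import Defs.
From HB Require Import structures.
From mathcomp Require Import all_boot all_order all_algebra.
From mathcomp Require Import all_classical all_reals all_analysis.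
From mathcomp Require Import Rstruct Rstruct_topology.
From mathcomp Require Import ring lra.
Import Order.TTheory GRing.Theory Num.Theory.
Import numFieldNormedType.Exports.
Set Implicit Arguments.
Unset Strict Implicit.
Unset Printing Implicit Defensive.
Local Open Scope classical_set_scope.
Local Open Scope ring_scope.

(** Let [O] be an interior point of [P] and let [E] be the edge whose line is farthest from [O].

    A facet is cut out of its plane by finitely many walls, each meeting it in an edge, hence at an
    angle at most [pi/2]; so the projection of [P] to the plane of a facet lies in that facet, and
    therefore the outward unit normals [e_i] satisfy [(e_i,e_j) <= 0] for all [i <> j], adjacent or
    not. This makes everything explicit: the foot of [O] on the line of [F_i] and [F_j] is an
    inner point of the edge, and the common perpendicular of two disjoint facet planes
    joins points of the facets, so that the width of a ridge is at most
    [max(1, -(e_3,e_4))].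

    Decompose [e_3], [e_4] along the normals [e_1], [e_2] of the two facets through [E], the foot
    [p] of [O] and the direction [u] of [E]. Maximality of [E] bounds the distances from [O] to the
    facets of the ridge, hence the components [y_3 = -(e_3,p)], [y_4 = -(e_4,p)]; with [X_3], [X_4]
    the components in the span of [e_1], [e_2], AM-GM gives
      [-(e_3,e_4) <= 1 + (y_3^2 - |X_3|^2/2) + (y_4^2 - |X_4|^2/2) - (X_3,X_4)],
    and the right-hand side is at most [5.65] for all angles. Hence [t] can be taken constant. The
    type [alpha0] occurs in the compact simplex with Coxeter diagram [5,3^{1,1}]. *)

(** * The Lorentzian form *)

Lemma lorDl x y z : lor (x + y) z = lor x z + lor y z.
Proof. by rewrite -big_split; apply: eq_bigr => i _; rewrite mxE mulrDr mulrDl. Qed.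

Lemma lorZl a x z : lor (a *: x) z = a * lor x z.
Proof. by rewrite big_distrr; apply: eq_bigr => i _ /=; rewrite mxE; ring. Qed.

Lemma lorC x y : lor x y = lor y x.
Proof. by apply: eq_bigr => i _; rewrite -!mulrA [x _ _ * _]mulrC. Qed.

Lemma lorDr x y z : lor x (y + z) = lor x y + lor x z.
Proof. by rewrite lorC lorDl !(lorC x). Qed.

Lemma lorZr a x z : lor x (a *: z) = a * lor x z.
Proof. by rewrite lorC lorZl lorC. Qed.

Lemma lorNl x z : lor (- x) z = - lor x z.
Proof. by rewrite -scaleN1r lorZl mulN1r. Qed.

Lemma lorNr x z : lor x (- z) = - lor x z.
Proof. by rewrite lorC lorNl lorC. Qed.

Lemma lor0l z : lor 0 z = 0.
Proof. by rewrite -(scale0r 0) lorZl mul0r. Qed.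

Lemma lor0r z : lor z 0 = 0.
Proof. by rewrite lorC lor0l. Qed.

Definition lorE := (lorDl, lorDr, lorZl, lorZr, lorNl, lorNr, lor0l, lor0r).

Definition sp (x : vec) (i : 'I_3) : R := x ord0 (lift ord0 i).
Notation ax0 := (@Ordinal 3 0 isT).
Notation ax1 := (@Ordinal 3 1 isT).
Notation ax2 := (@Ordinal 3 2 isT).

Lemma lor_coord x y : lor x y =
  - (x ord0 ord0 * y ord0 ord0) + (sp x ax0 * sp y ax0 + sp x ax1 * sp y ax1 + sp x ax2 * sp y ax2).
Proof.
rewrite /lor !big_ord_recl big_ord0 /= /sp !mul1r mulN1r mulNr addr0 !addrA.
by do ![congr (_ + _)]; congr (_ * _); congr (_ _ _); apply: val_inj.
Qed.

Lemma lor_nondeg x : (forall y, lor x y = 0) -> x = 0.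
Proof.
move=> h; apply/rowP => i; rewrite mxE.
have := h (delta_mx ord0 i); rewrite /lor (bigD1 i) //= big1 => [|j ji].
  rewrite addr0 mxE !eqxx mulr1 => /eqP; rewrite mulf_eq0 => /orP[|/eqP //].
  by case: ifP => _; rewrite ?oppr_eq0 oner_eq0.
by rewrite mxE (negbTE ji) andbF mulr0.
Qed.

Lemma cs3 (a b c x y z : R) : (a * x + b * y + c * z) ^+ 2 <=
  (a ^+ 2 + b ^+ 2 + c ^+ 2) * (x ^+ 2 + y ^+ 2 + z ^+ 2).
Proof.
rewrite -subr_ge0.
have -> : (a ^+ 2 + b ^+ 2 + c ^+ 2) * (x ^+ 2 + y ^+ 2 + z ^+ 2) - (a * x + b * y + c * z) ^+ 2
  = (a * y - b * x) ^+ 2 + (a * z - c * x) ^+ 2 + (b * z - c * y) ^+ 2 by ring.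
by rewrite !addr_ge0 ?sqr_ge0.
Qed.

(** Cauchy-Schwarz for the spatial parts: orthogonality makes their product [u0 * x0], and the
    spatial part of a timelike [x] is shorter than its time coordinate. *)
Lemma lor_perp_ge0 x u : lor x x < 0 -> lor u x = 0 -> 0 <= lor u u.
Proof.
rewrite !lor_coord; set x0 := x _ _; set u0 := u _ _ => hx hu.
have := @cs3 (sp u ax0) (sp u ax1) (sp u ax2) (sp x ax0) (sp x ax1) (sp x ax2).
set A := _ ^+ 2 + _ + _; set B := _ ^+ 2 + _ + _; set C := _ + _.
have -> : C = u0 * x0 by rewrite /C; lra.
have HB : B < x0 ^+ 2 by rewrite /B; move: hx; lra.
have A0 : 0 <= A by rewrite !addr_ge0 ?sqr_ge0.
move=> h.
suff : u0 ^+ 2 <= A by rewrite /A; lra.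
have x0p : 0 < x0 ^+ 2 by apply: le_lt_trans HB; rewrite !addr_ge0 ?sqr_ge0.
rewrite -(ler_pM2r x0p) -exprMn (le_trans h) // ler_wpM2l //; exact: ltW.
Qed.

Lemma lor_perp_eq0 x u : lor x x < 0 -> lor u x = 0 -> lor u u = 0 -> u = 0.
Proof.
move=> hx hu huu; apply: lor_nondeg => y.
(* A null vector of the semidefinite form on the orthogonal of [x] lies in its radical. *)
have [v hv ->] : exists2 v, lor v x = 0 & lor u y = lor u v.
  exists (y - (lor y x / lor x x) *: x); rewrite !lorE; last by rewrite hu; ring.
  by field; apply: ltr0_neq0.
have q t : 0 <= 2 * t * lor u v + lor v v.
  have -> : 2 * t * lor u v + lor v v = lor (t *: u + v) (t *: u + v).
    by rewrite !lorE huu (lorC v u); ring.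
  by apply: (@lor_perp_ge0 x) => //; rewrite !lorE hu hv; ring.
apply/eqP; apply: contraT => nz.
(* At this parameter the affine expression bounded below in [q] equals -1. *)
have := q (- (lor v v + 1) / (2 * lor u v)).
have -> : 2 * (- (lor v v + 1) / (2 * lor u v)) * lor u v = - (lor v v + 1).
  by field.
lra.
Qed.

Lemma lor_perp_gt0 x u : lor x x < 0 -> lor u x = 0 -> u <> 0 -> 0 < lor u u.
Proof.
move=> hx hu u0; rewrite lt_neqAle (lor_perp_ge0 hx hu) andbT eq_sym.
by apply/eqP => /(lor_perp_eq0 hx hu).
Qed.

Lemma lor_perp_cs x u v : lor x x < 0 -> lor u x = 0 -> lor v x = 0 ->
  lor u v ^+ 2 <= lor u u * lor v v.
Proof.
move=> hx hu hv; have [v0|v0] := eqVneq v 0.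
  by rewrite v0 !lorE mulr0 expr0n.
have vp : 0 < lor v v by apply: (lor_perp_gt0 hx hv); apply/eqP.
have : 0 <= lor (lor v v *: u - lor u v *: v) (lor v v *: u - lor u v *: v).
  by apply: (@lor_perp_ge0 x); rewrite // !lorE hu hv; ring.
rewrite !lorE (lorC v u) => h; rewrite -subr_ge0 -(pmulr_rge0 _ vp); move: h.
by congr (_ <= _); ring.
Qed.

(** * Time orientation and the hyperboloid *)

Definition future (x : vec) := lor x x < 0 /\ 0 < x ord0 ord0.

Lemma H3_future x : H3 x -> future x.
Proof. by case=> h ?; split=> //; rewrite h; lra. Qed.

Lemma future_lor x y : future x -> future y -> lor x y < 0.
Proof.
move=> [hx x0p] [hy y0p]; move: hx hy; rewrite !lor_coord => hx hy.
have h := @cs3 (sp y ax0) (sp y ax1) (sp y ax2) (sp x ax0) (sp x ax1) (sp x ax2).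
move: h hx hy; set A := _ ^+ 2 + _ + _; set B := _ ^+ 2 + _ + _; set C := _ + _ => h hx hy.
have HA : A < y ord0 ord0 ^+ 2 by rewrite expr2; lra.
have HB : B < x ord0 ord0 ^+ 2 by rewrite expr2; lra.
have A0 : 0 <= A by rewrite !addr_ge0 ?sqr_ge0.
have B0 : 0 <= B by rewrite !addr_ge0 ?sqr_ge0.
have : C ^+ 2 < (x ord0 ord0 * y ord0 ord0) ^+ 2.
  by apply: le_lt_trans h _; rewrite exprMn mulrC ltr_pM.
have hxy : 0 <= x ord0 ord0 * y ord0 ord0 by rewrite mulr_ge0 ?ltW.
have -> : sp x ax0 * sp y ax0 + sp x ax1 * sp y ax1 + sp x ax2 * sp y ax2 = C by rewrite /C; ring.
by move=> hC; rewrite addrC subr_lt0 ltNge; apply/negP => hh; nra.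
Qed.

(** The sign of coordinate 0 is read off from the product with one known future vector, which avoids
    computing that coordinate for points built from [O]. *)
Lemma future_inv O x : future O -> lor x x < 0 -> lor x O < 0 -> future x.
Proof.
move=> hO hx hxO; split => //.
have [//|n0|/esym z0] := ltgtP 0 (x ord0 ord0).
  have : future (- x) by split; rewrite ?mxE ?lorE; lra.
  by move=> /future_lor /(_ hO); rewrite lorE; lra.
move: hx; rewrite lor_coord z0.
by have := sqr_ge0 (sp x ax0); have := sqr_ge0 (sp x ax1); have := sqr_ge0 (sp x ax2); lra.
Qed.

(** Radial projection onto the hyperboloid. The inequalities of a cell are homogeneous, so points
    can be built as timelike vectors and normalised at the end. *)
Definition hnorm (x : vec) : vec := (Num.sqrt (- lor x x))^-1 *: x.

Lemma hnorm_scale x : lor x x < 0 -> exists2 c, 0 < c & hnorm x = c *: x.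
Proof.
by move=> hx; exists (Num.sqrt (- lor x x))^-1; rewrite // invr_gt0 sqrtr_gt0 oppr_gt0.
Qed.

Lemma hnorm_H3 x : future x -> H3 (hnorm x).
Proof.
move=> [hx x0]; have s0 : 0 < Num.sqrt (- lor x x) by rewrite sqrtr_gt0 oppr_gt0.
split; last by rewrite mxE mulr_gt0 ?invr_gt0.
rewrite /hnorm !lorE; have := @sqr_sqrtr _ (- lor x x); rewrite oppr_ge0 => /(_ (ltW hx)).
set s := Num.sqrt _ in s0 *; move=> e.
have -> : lor x x = - s ^+ 2 by rewrite e opprK.
by field; apply: lt0r_neq0.
Qed.

Lemma H3_lor_lt0 x y : H3 x -> H3 y -> lor x y < 0.
Proof. by move=> hx hy; apply: future_lor; apply: H3_future. Qed.

(** The vector [y + (x,y) x] is orthogonal to [x], hence its square [(x,y)^2 - 1] is nonnegative. *)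
Lemma H3_lor_leN1 x y : H3 x -> H3 y -> lor x y <= -1.
Proof.
move=> hx hy; have h := H3_lor_lt0 hx hy.
have hxx : lor x x < 0 by case: hx => ->; lra.
have : 0 <= lor (y + lor x y *: x) (y + lor x y *: x).
  by apply: (@lor_perp_ge0 x) => //; rewrite !lorE (proj1 hx) (lorC y x); ring.
by rewrite !lorE (proj1 hx) (proj1 hy) (lorC y x); nra.
Qed.

Lemma H3_scale_eq x y c : H3 x -> H3 y -> y = c *: x -> y = x.
Proof.
move=> hx hy e; have : c ^+ 2 = 1 by have := proj1 hy; rewrite e !lorE (proj1 hx); lra.
have c0 : 0 < c.
  by have := proj2 hy; rewrite e mxE pmulr_lgt0 //; exact: (proj2 hx).
move=> c1; have {}c1 : c = 1 by nra.
by rewrite e c1 scale1r.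
Qed.

(** * Linear independence and orthogonality *)

Lemma row_freeE m (A : 'M[R]_(m, 4)) :
  (forall c : 'rV[R]_m, c *m A = 0 -> c = 0) -> row_free A.
Proof.
move=> h; rewrite -kermx_eq0; apply/eqP/row_matrixP => i; rewrite row0.
by apply: h; rewrite -row_mul mulmx_ker row0.
Qed.

Definition lorJ : 'M[R]_4 := diag_mx (\row_(i < 4) (if i == 0 :> nat then -1 else 1)).

Lemma lorJ_unit : lorJ \in unitmx.
Proof.
suff /mulmx1_unit[] : lorJ *m lorJ = 1%:M by [].
rewrite mulmx_diag; apply/matrixP => i j; rewrite !mxE.
by case: (i == j); case: (nat_of_ord i == 0)%N; rewrite ?mulr1n ?mulr0n // ?mulrNN mulr1.
Qed.

Lemma lor_mulmx m k (x : 'I_m -> vec) (f : 'I_k -> vec) :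
  (\matrix_(i < m) x i) *m (lorJ *m (\matrix_(i < k) f i)^T) = \matrix_(i, j) lor (x i) (f j).
Proof.
apply/matrixP => i j; rewrite !mxE; apply: eq_bigr => l _.
rewrite mul_diag_mx !mxE mulrA [x i _ _ * _]mulrC.
by [].
Qed.

(** Multiplication by the invertible [lorJ] preserves the rank, so orthogonal subspaces have total
    dimension at most four. The upper bounds on the dimensions of facets and edges come from
    here. *)
Lemma indep_orth m k (x : 'I_m -> vec) (f : 'I_k -> vec) :
  row_free (\matrix_(i < m) x i) -> row_free (\matrix_(i < k) f i) ->
  (forall i j, lor (x i) (f j) = 0) -> (m + k <= 4)%N.
Proof.
move=> /eqP rx /eqP rf h.
have := @mulmx0_rank_max _ _ _ _ (\matrix_(i < m) x i) (lorJ *m (\matrix_(i < k) f i)^T).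
rewrite lor_mulmx rx (eqmxMfull _ _); last by rewrite row_full_unit lorJ_unit.
rewrite mxrank_tr rf; apply; apply/matrixP => i j; rewrite !mxE; exact: h.
Qed.

Lemma exists_orth (f : 'I_3 -> vec) : exists2 u : vec, u <> 0 & forall i, lor u (f i) = 0.
Proof.
set M := lorJ *m (\matrix_(i < 3) f i)^T.
have : kermx M != 0.
  rewrite kermx_eq0 /row_free; apply/negP => /eqP e.
  by have := rank_leq_col M; rewrite e.
move=> /rowV0Pn[u]; rewrite sub_kermx => /eqP hu u0.
exists u; first exact/eqP.
move=> i; have := @lor_mulmx 1 3 (fun=> u) f.
have -> : \matrix_(i < 1) u = u by apply/rowP => j; rewrite mxE.
by rewrite hu => /matrixP /(_ ord0 i); rewrite !mxE.
Qed.

(** * Cells and their walls *)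

Lemma H3_lor_lt0_self x : H3 x -> lor x x < 0.
Proof. by case=> -> _; lra. Qed.

Lemma H3_indep2 (F : set vec) x y : H3 x -> H3 y -> x <> y -> F x -> F y -> has_indep F 2.
Proof.
move=> hx hy xy Fx Fy; exists (fun i => if i == 0 :> nat then x else y); split.
  by move=> i; case: ifP.
apply: row_freeE => c; rewrite mulmx_sum_row !big_ord_recl big_ord0 addr0 !rowK /= => h.
have [c1|c1] := eqVneq (c ord0 (lift ord0 ord0)) 0.
  move: h; rewrite c1 scale0r addr0 => h.
  have : lor (c ord0 ord0 *: x) x = 0 by rewrite h lor0l.
  rewrite lorE (proj1 hx) => c0; apply/rowP => i; rewrite mxE.
  case: (unliftP ord0 i) => [j ->|->]; last by lra.
  by rewrite (ord1 j).
case: xy; apply/esym/(@H3_scale_eq _ _ (- c ord0 ord0 / c ord0 (lift ord0 ord0))) => //.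
move/eqP: h; rewrite addrC addr_eq0 => /eqP; move/(congr1 -%R); rewrite opprK => h.
apply: (scalerI c1); rewrite scalerA.
have -> : c ord0 (lift ord0 ord0) * (- c ord0 ord0 / c ord0 (lift ord0 ord0)) = - c ord0 ord0 by field.
by rewrite scaleNr -h opprK.
Qed.

(** The scalars [a] and [b] stand for the normalising factors of [hnorm]: the three points are [p]
    and two points reached from it in orthogonal tangent directions. *)
Lemma indep3 (F : set vec) p u v a b : lor p p < 0 -> u <> 0 -> v <> 0 ->
  lor u p = 0 -> lor v p = 0 -> lor u v = 0 -> a != 0 -> b != 0 ->
  F p -> F (a *: (p + u)) -> F (b *: (p + v)) -> has_indep F 3.
Proof.
move=> hp u0 v0 up vp uv a0 b0 Fp Fa Fb.
have uu := lor_perp_gt0 hp up u0; have vv := lor_perp_gt0 hp vp v0.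
exists (fun i => if i == 0 :> nat then p else if i == 1 :> nat then a *: (p + u) else b *: (p + v)).
split; first by move=> i; do ![case: ifP => // _].
apply: row_freeE => c; rewrite mulmx_sum_row !big_ord_recl big_ord0 addr0 !rowK /=.
set c0 := c _ _; set c1 := c _ _; set c2 := c _ _ => h.
have := congr1 (fun z => lor z u) h; have := congr1 (fun z => lor z v) h.
have := congr1 (fun z => lor z p) h; rewrite /= !lorE (lorC p u) (lorC p v) (lorC v u) up vp uv.
rewrite !(mulr0, addr0, add0r) => h0 h2 h1.
have c1E : c1 = 0.
  by move/eqP: h1; rewrite !mulf_eq0 (negbTE a0) (gt_eqF uu) !orbF => /eqP.
have c2E : c2 = 0.
  by move/eqP: h2; rewrite !mulf_eq0 (negbTE b0) (gt_eqF vv) !orbF => /eqP.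
have c0E : c0 = 0.
  by move/eqP: h0; rewrite c1E c2E !(mul0r, addr0) mulf_eq0 (lt_eqF hp) orbF => /eqP.
apply/rowP => i; rewrite mxE; case: (unliftP ord0 i) => [j ->|-> //].
by case: (unliftP ord0 j) => [k ->|-> //]; rewrite (ord1 k).
Qed.

Lemma indep_gram e f : lor e e = 1 -> lor f f = 1 -> lor e f ^+ 2 < 1 ->
  row_free (\matrix_(i < 2) (if i == 0 :> nat then e else f)).
Proof.
move=> he hf hg; apply: row_freeE => c; rewrite mulmx_sum_row !big_ord_recl big_ord0 addr0 !rowK /=.
set c0 := c _ _; set c1 := c _ _ => h.
have := congr1 (fun z => lor z e) h; have := congr1 (fun z => lor z f) h.
rewrite /= !lorE (lorC f e) he hf; set g := lor e f in hg *; rewrite !mulr1 => h1 h0.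
have n0 : 1 - g ^+ 2 != 0 by rewrite gt_eqF // subr_gt0.
have c1E : c1 = 0.
  apply/eqP; rewrite -[_ == 0]orbF -(negbTE n0) -mulf_eq0; apply/eqP.
  have -> : c1 * (1 - g ^+ 2) = (c0 * g + c1) - g * (c0 + c1 * g) by ring.
  by rewrite h1 h0; ring.
have c0E : c0 = 0 by move: h0; rewrite c1E mul0r addr0.
by apply/rowP => i; rewrite mxE; case: (unliftP ord0 i) => [j ->|-> //]; rewrite (ord1 j).
Qed.

(** The part of [e] orthogonal to [f] is orthogonal to the timelike [x], so its square [1 - (e,f)^2]
    is positive unless that part vanishes. Then [e = f] or [e = -f], and the latter is impossible
    with [O] on the negative side of both. *)
Lemma gram_lt1 x O e f : lor x x < 0 -> lor x e = 0 -> lor x f = 0 ->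
  lor e e = 1 -> lor f f = 1 -> e <> f -> lor O e < 0 -> lor O f < 0 -> lor e f ^+ 2 < 1.
Proof.
move=> hx xe xf he hf ef Oe Of.
have h : lor (e - lor e f *: f) x = 0 by rewrite !lorE (lorC e) (lorC f) xe xf; ring.
have [w0|/eqP w0] := eqVneq (e - lor e f *: f) 0; last first.
  have := lor_perp_gt0 hx h w0; rewrite !lorE (lorC f e) he hf.
  by move=> ?; lra.
move/eqP: w0; rewrite subr_eq0 => /eqP eE.
have e1 : lor e f ^+ 2 = 1.
  by have := he; rewrite {1 2}eE !lorE hf; lra.
have : lor O e = lor e f * lor O f by rewrite {1}eE lorE.
move=> hO; have g0 : 0 < lor e f by nra.
have {}e1 : lor e f = 1 by nra.
by case: ef; rewrite eE e1 scale1r.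
Qed.

Definition cell n (e : 'I_n -> vec) : set vec :=
  [set x | H3 x /\ forall i, lor x (e i) <= 0].

Definition wall (P : set vec) (e : vec) : set vec := [set x | P x /\ lor x e = 0].

Lemma cell_hnorm n (e : 'I_n -> vec) x :
  future x -> (forall i, lor x (e i) <= 0) -> cell e (hnorm x).
Proof.
move=> hx h; split; first exact: hnorm_H3.
move=> i; have [c c0 ->] := hnorm_scale (proj1 hx).
by rewrite lorE pmulr_rle0.
Qed.

Lemma small_forall n (Q : 'I_n -> R -> Prop) :
  (forall i, exists2 d, 0 < d & forall t, 0 < t <= d -> Q i t) ->
  exists2 d, 0 < d & forall t, 0 < t <= d -> forall i, Q i t.
Proof.
elim: n Q => [|n IH] Q h; first by exists 1 => // t _ [].
have [d d0 hd] := IH (fun i => Q (lift ord0 i)) (fun i => h (lift ord0 i)).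
have [d' d'0 hd'] := h ord0.
exists (Num.min d d'); first by rewrite lt_min d0.
move=> t; rewrite le_min => /and3P[t0 td td'] i.
by case: (unliftP ord0 i) => [j ->|->]; [apply: hd|apply: hd']; rewrite t0.
Qed.

Lemma small_affine (a b : R) : a < 0 -> exists2 d, 0 < d & forall t, 0 < t <= d -> a + t * b <= 0.
Proof.
move=> a0; exists (- a / (`|b| + 1)).
  by rewrite divr_gt0 ?oppr_gt0 // ltr_pwDr.
move=> t /andP[t0]; rewrite ler_pdivlMr ?ltr_pwDr // => h.
have : b <= `|b| by exact: ler_norm.
by nra.
Qed.

Lemma small_future p u : H3 p -> exists2 d, 0 < d & forall t, 0 < t <= d -> future (p + t *: u).
Proof.
move=> hp.
(* Both the square and the product with [p] are -1 at [t = 0]; the two choices keep them at most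
   -1/2, the quadratic term being absorbed by [t <= 1]. *)
have [d d0 hd] := @small_affine (- 2^-1) (2 * lor u p + `|lor u u|) ltac:(lra).
have [d' d'0 hd'] := @small_affine (- 2^-1) (lor u p) ltac:(lra).
exists (Num.min (Num.min d d') 1); first by rewrite !lt_min d0 d'0 ltr01.
move=> t; rewrite !le_min => /and3P[t0 /andP[td td'] t1].
have h1 := hd t ltac:(by rewrite t0); have h2 := hd' t ltac:(by rewrite t0).
have uu : t ^+ 2 * lor u u <= t * `|lor u u|.
  rewrite expr2 -mulrA ler_wpM2l ?(ltW t0) //; apply: (@le_trans _ _ (t * `|lor u u|)).
    by rewrite ler_wpM2l ?(ltW t0) ?ler_norm.
  by rewrite ler_piMl.
apply: (future_inv (H3_future hp)); rewrite !lorE (proj1 hp) ?(lorC p u).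
  by move: uu h1; lra.
by lra.
Qed.

(** Walls missed by [p] stay missed for small [t]; for a wall through [p] the sign of [(u, e i)]
    decides for all positive [t]. *)
Lemma cell_nbhd n (e : 'I_n -> vec) p u : H3 p ->
  (forall i, lor p (e i) < 0 \/ lor p (e i) = 0 /\ lor u (e i) <= 0) ->
  exists2 d, 0 < d & forall t, 0 < t <= d ->
    future (p + t *: u) /\ forall i, lor (p + t *: u) (e i) <= 0.
Proof.
move=> hp h; have [d d0 hd] := small_future u hp.
have [|d' d'0 hd'] := @small_forall n (fun i t => lor (p + t *: u) (e i) <= 0).
  move=> i; case: (h i) => [h0|[h0 h1]].
    have [d' d'0 hd'] := small_affine (lor u (e i)) h0.
    by exists d' => // t /hd'; rewrite !lorE.
  by exists 1 => // t /andP[t0 _]; rewrite !lorE h0 add0r pmulr_rle0.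
exists (Num.min d d'); first by rewrite lt_min d0.
move=> t; rewrite le_min => /and3P[t0 td td']; split; first by apply: hd; rewrite t0.
by apply: hd'; rewrite t0.
Qed.

(** [O] is strictly inside every half-space. The family may still contain redundant normals;
    irredundance is stated separately where it is required. *)
Definition system n (e : 'I_n -> vec) O :=
  [/\ forall i, lor (e i) (e i) = 1, H3 O & forall i, lor O (e i) < 0].

Lemma exists_orth1 x : exists2 u : vec, u <> 0 & lor u x = 0.
Proof. by have [u u0 h] := exists_orth (fun=> x); exists u => //; exact: (h ord0). Qed.

Lemma exists_orth2 x y : exists2 u : vec, u <> 0 & lor u x = 0 /\ lor u y = 0.
Proof.
have [u u0 h] := exists_orth (fun i => if i == 0 :> nat then x else y).
by exists u => //; have := h ord0; have := h (lift ord0 ord0); rewrite /=.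
Qed.

Lemma exists_orth3 x y z :
  exists2 u : vec, u <> 0 & [/\ lor u x = 0, lor u y = 0 & lor u z = 0].
Proof.
have [u u0 h] := exists_orth
  (fun i => if i == 0 :> nat then x else if i == 1 :> nat then y else z).
exists u => //; have := h ord0; have := h (lift ord0 ord0).
by have := h (lift ord0 (lift ord0 ord0)); rewrite /=.
Qed.

(** Small moves from [p] in two orthogonal directions tangent to the wall give three independent
    points; orthogonality to [e i] excludes a fourth. *)
Lemma facet_wall n (e : 'I_n -> vec) O i p : system e O ->
  H3 p -> lor p (e i) = 0 -> (forall j, j != i -> lor p (e j) < 0) ->
  facet (cell e) (wall (cell e) (e i)).
Proof.
move=> [e1 hO Oe] hp pi0 hs.
have cp : cell e p.
  by split=> // j; have [->|/hs/ltW //] := eqVneq j i; rewrite pi0.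
split.
  exists (e i); rewrite e1; split; first exact: ltr01.
  by split; [move=> x [_ h]; exact: h|split=> //; exists p].
have [u u0 [up ui]] := exists_orth2 p (e i).
have [v v0 [vp vi uv]] := exists_orth3 p (e i) u.
have nb w : lor w (e i) = 0 -> exists2 d, 0 < d & forall t, 0 < t <= d ->
    future (p + t *: w) /\ wall (cell e) (e i) (hnorm (p + t *: w)).
  move=> wi; have [|d d0 hd] := @cell_nbhd n e p w hp.
    by move=> j; have [->|/hs] := eqVneq j i; [right; rewrite pi0 wi|left].
  exists d => // t /hd[hf hc]; split=> //; split; first exact: cell_hnorm.
  by have [c _ ->] := hnorm_scale (proj1 hf); rewrite !lorE pi0 wi; ring.
have [d d0 /(_ d)] := nb u ui; have [d' d'0 /(_ d')] := nb v vi.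
rewrite d0 d'0 !lexx => /(_ isT)[[f' _] w'] /(_ isT)[[f _] w].
split.
  have [c c0 hc] := hnorm_scale f; have [c' c'0 hc'] := hnorm_scale f'.
  rewrite hc in w; rewrite hc' in w'.
  apply: (@indep3 _ p (d *: u) (d' *: v) c c' (H3_lor_lt0_self hp)) => //.
  - by move/eqP; rewrite scaler_eq0 (gt_eqF d0) => /eqP.
  - by move/eqP; rewrite scaler_eq0 (gt_eqF d'0) => /eqP.
  - by rewrite lorE up mulr0.
  - by rewrite lorE vp mulr0.
  - by rewrite !lorE (lorC u) uv !mulr0.
  - by rewrite gt_eqF.
  - by rewrite gt_eqF.
case=> x [hx rx]; have := @indep_orth 4 1 x (fun=> e i) rx.
have h : row_free (\matrix_(_ < 1) e i).
  apply: row_freeE => c; rewrite mulmx_sum_row big_ord1 rowK => /(congr1 (fun z => lor z (e i))) /=.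
  rewrite !lorE e1 mulr1 => c0; apply/rowP => k; by rewrite mxE (ord1 k).
by move=> /(_ h (fun k _ => proj2 (hx k))).
Qed.

Lemma edge_wall n (e : 'I_n -> vec) O i j p q : system e O -> e i <> e j ->
  p <> q -> (wall (cell e) (e i) `&` wall (cell e) (e j)) p ->
  (wall (cell e) (e i) `&` wall (cell e) (e j)) q ->
  lor (e i) (e j) ^+ 2 < 1 /\ edge (cell e) (wall (cell e) (e i) `&` wall (cell e) (e j)).
Proof.
move=> [e1 hO Oe] eij pq Fp Fq.
have [[cp pi] [_ pj]] := Fp; have [[cq _] _] := Fq.
have hp := H3_lor_lt0_self (proj1 cp).
have g1 := gram_lt1 hp pi pj (e1 i) (e1 j) eij (Oe i) (Oe j).
split=> //; split.
  (* The sum of two outward normals supports the cell exactly along the intersection: nonpositive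
     numbers with sum zero both vanish. *)
  exists (e i + e j); split.
    by rewrite !lorE !e1 (lorC (e j)); nra.
  split; first by move=> x [_ hx]; rewrite !lorE; have := hx i; have := hx j; lra.
  split; last by exists p.
  apply/seteqP; split=> x /=.
    by move=> [[cx xi] [_ xj]]; rewrite !lorE xi xj addr0.
  move=> [cx]; rewrite !lorE => h; have := proj2 cx i; have := proj2 cx j.
  by split; split=> //; lra.
split; first exact: (H3_indep2 (proj1 cp) (proj1 cq) pq).
case=> x [hx rx]; suff : (3 + 2 <= 4)%N by [].
apply: (indep_orth rx (indep_gram (e1 i) (e1 j) g1)) => k l.
by have [[_ ?] [_ ?]] := hx k; case: ifP.
Qed.

(** Serves twice: for the walls of the whole polytope, and for the walls that cut a single facet out
    of its plane. *)
Lemma minimal_family (T : Type) (Q : forall m, ('I_m -> T) -> Prop) m0 (f0 : 'I_m0 -> T) :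
  Q m0 f0 -> exists m (f : 'I_m -> T), Q m f /\ forall i, ~ Q m.-1 (f \o lift i).
Proof.
elim: m0 f0 => [|m IH] f0 hf; first by exists 0%N, f0; split=> // -[].
have [[i hi]|h] := pselect (exists i, Q m (f0 \o lift i)); first exact: IH hi.
by exists m.+1, f0; split=> // i hi; apply: h; exists i.
Qed.

(* Moving from [O] towards a point violating only the [i]-th inequality, one leaves through the
   relative interior of the [i]-th wall. *)
Lemma crossing_point m (f : 'I_m -> vec) w O y i : H3 O -> H3 y ->
  lor O w = 0 -> lor y w = 0 -> (forall j, lor O (f j) < 0) ->
  0 < lor y (f i) -> (forall j, j != i -> lor y (f j) <= 0) ->
  exists p, [/\ H3 p, lor p w = 0, lor p (f i) = 0 & forall j, j != i -> lor p (f j) < 0].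
Proof.
move=> hO hy Ow yw Of yi yj.
have [p [fp pw pi pj]] : exists p,
    [/\ future p, lor p w = 0, lor p (f i) = 0 & forall j, j != i -> lor p (f j) < 0].
  (* Both weights are positive, and they are chosen to cancel the products with [f i]. *)
  exists (lor y (f i) *: O - lor O (f i) *: y).
  have h2 := Of i; rewrite -oppr_gt0 in h2.
  split; rewrite ?lorE ?Ow ?yw; try ring; last first.
    by move=> j ji; rewrite !lorE; have := yj j ji; have := Of j; nra.
  split; last first.
    have h1 := mulr_gt0 yi (proj2 hO); have h3 := mulr_gt0 h2 (proj2 hy).
    by rewrite !mxE; lra.
  rewrite !lorE (proj1 hO) (proj1 hy) (lorC y O).
  have := H3_lor_lt0 hO hy; move: h2 yi; set a := lor y _; set b := lor O (f i).
  set g := lor O y => b0 a0 g0; have : 0 < a * (- b * - g) by rewrite ?mulr_gt0 ?(oppr_gt0 g).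
  by nra.
have [c c0 pE] := hnorm_scale (proj1 fp).
exists (hnorm p); split; first exact: hnorm_H3.
- by rewrite pE lorE pw mulr0.
- by rewrite pE lorE pi mulr0.
by move=> j ji; rewrite pE lorE pmulr_rlt0 ?pj.
Qed.

(** * Compact cells have no ideal points *)

Lemma coord_norm (x : vec) i : `|x ord0 i| <= `|x|.
Proof.
rewrite [leRHS]/Num.Def.normr /= mx_normrE.
exact: (le_bigmax 0 (fun ij => `|x ij.1 ij.2|) (ord0, i)).
Qed.

Lemma compact_bounded_lor (P : set vec) p : compact P ->
  exists2 M, 0 <= M & forall x, P x -> `|lor x p| <= M.
Proof.
move=> /compact_bounded[M [_ /(_ (Num.max M 0 + 1))]].
rewrite ltr_pwDr ?le_max ?lexx // => /(_ isT) h.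
have M0 : 0 <= Num.max M 0 + 1 by rewrite addr_ge0 // le_max lexx orbT.
exists (\sum_(i < 4) (Num.max M 0 + 1) * `|p ord0 i|).
  by apply: sumr_ge0 => i _; rewrite mulr_ge0.
move=> x /h hx; apply: le_trans (ler_norm_sum _ _ _) _; apply: ler_sum => i _.
rewrite normrM ler_wpM2r // normrM.
by case: ifP => _; rewrite ?normrN normr1 mul1r; apply: le_trans (coord_norm _ _) hx.
Qed.

(** Along the normalised ray the product with [p] grows like the square root of the parameter,
    whereas compactness bounds it. *)
Lemma compact_no_null_ray (P : set vec) p v : compact P -> H3 p -> lor v v = 0 -> lor v p < 0 ->
  ~ (forall t, 0 <= t -> P (hnorm (p + t *: v))).
Proof.
move=> cP hp vv vp hP; have [M M0 hM] := compact_bounded_lor p cP.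
set s := - lor v p; have s0 : 0 < s by rewrite oppr_gt0.
(* The bound [M] would force [(1 + tau)^2 <= M^2 (1 + 2 tau)], which fails for this value. *)
pose tau := 2 * M ^+ 2 + 1; have tau0 : 0 < tau by rewrite /tau; nra.
have t0 : 0 <= tau / s by rewrite divr_ge0 // ltW.
have q1 : lor (p + (tau / s) *: v) (p + (tau / s) *: v) = - (1 + 2 * tau).
  by rewrite !lorE vv (proj1 hp) (lorC p v) -[lor v p]opprK -/s; field; rewrite gt_eqF.
have q2 : lor (p + (tau / s) *: v) p = - (1 + tau).
  by rewrite !lorE (proj1 hp) -[lor v p]opprK -/s; field; rewrite gt_eqF.
have fut : future (p + (tau / s) *: v).
  by apply: (future_inv (H3_future hp)); rewrite ?q1 ?q2; lra.
have := hM _ (hP _ t0); have := proj1 (hnorm_H3 fut).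
have [c c0 ->] := hnorm_scale (proj1 fut); rewrite !lorZl lorZr q1 q2 => e1.
rewrite mulrN normrN ger0_norm; last by rewrite mulr_ge0; lra.
move=> e2; have : (c * (1 + tau)) ^+ 2 <= M ^+ 2.
  by rewrite ler_sqr ?nnegrE // mulr_ge0 //; lra.
have c2 : c ^+ 2 = (1 + 2 * tau)^-1.
  by apply: (mulIf (_ : 1 + 2 * tau != 0)); [rewrite gt_eqF //; lra|rewrite mulVf; [lra|rewrite gt_eqF //; lra]].
rewrite exprMn c2 ler_pdivrMl; last by lra.
by rewrite /tau; nra.
Qed.

(** A null vector satisfying all the inequalities would be an ideal point of the cell, and the ray
    towards it from [p] would stay inside. *)
Lemma cell_no_null n (e : 'I_n -> vec) p v : compact (cell e) -> cell e p ->
  lor v v = 0 -> lor v p < 0 -> exists i, 0 < lor v (e i).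
Proof.
move=> cP [hp hpe] vv vp; apply: contrapT => h.
apply: (compact_no_null_ray cP hp vv vp) => t t0; apply: cell_hnorm.
  by apply: (future_inv (H3_future hp)); rewrite !lorE ?vv ?(lorC p v) (proj1 hp); nra.
move=> i; rewrite !lorE; have := hpe i.
have : lor v (e i) <= 0 by rewrite leNgt; apply/negP => h'; apply: h; exists i.
by nra.
Qed.

Lemma coxeter_gram n (e : 'I_n -> vec) O i j : system e O -> coxeter_polytope (cell e) ->
  facet (cell e) (wall (cell e) (e i)) -> facet (cell e) (wall (cell e) (e j)) ->
  wall (cell e) (e i) <> wall (cell e) (e j) ->
  edge (cell e) (wall (cell e) (e i) `&` wall (cell e) (e j)) ->
  lor (e i) (e j) ^+ 2 < 1 -> exists2 k : nat, (2 <= k)%N & lor (e i) (e j) = - cos (pi / k%:R).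
Proof.
move=> [e1 hO Oe] [_ hc] fi fj fij eij g1.
have on k : outward_normal (cell e) (wall (cell e) (e k)) (e k).
  by split=> //; split=> // x [_ h]; exact: h.
have [|k [k2 ak]] := hc _ _ fi fj fij eij (acos (- lor (e i) (e j))).
  by exists (e i), (e j).
by exists k; rewrite // -ak acosK ?opprK // in_itv /=; nra.
Qed.

Lemma angle_bounds (k : nat) : (2 <= k)%N -> 0 <= (pi : R) / k%:R <= (pi : R) / 2.
Proof.
move=> k2; have k0 : 0 < k%:R :> R by rewrite ltr0n; apply: leq_trans k2.
apply/andP; split; first by rewrite divr_ge0 ?pi_ge0 ?ler0n.
by rewrite ler_wpM2l ?pi_ge0 // lef_pV2 ?posrE // ler_nat.
Qed.

Lemma coxeter_gram_le0 (k : nat) : (2 <= k)%N -> 0 <= cos ((pi : R) / k%:R).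
Proof.
move=> /angle_bounds /andP[h1 h2]; apply: cos_ge0_pihalf; rewrite h2 andbT.
by apply: le_trans h1; rewrite oppr_le0 divr_ge0 ?pi_ge0.
Qed.

Lemma proj_future x e : H3 x -> lor e e = 1 -> future (x - lor x e *: e).
Proof.
move=> hx he; apply: (future_inv (H3_future hx)); rewrite !lorE ?(lorC e x) (proj1 hx) ?he.
  by nra.
by nra.
Qed.

(** Walls meeting the facet in an edge are settled by the Coxeter condition. For arbitrary [j], a
    point of wall [j] is projected to the plane of [e i]; the projection lies in the cell, and its
    product with [e j] has the sign of [(e i, e j)]. *)
Lemma nonobtuse n (e : 'I_n -> vec) O : system e O -> compact (cell e) ->
  coxeter_polytope (cell e) ->
  (forall i, exists p, [/\ H3 p, lor p (e i) = 0 & forall j, j != i -> lor p (e j) < 0]) ->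
  forall i, (exists2 j, j != i & lor (e i) (e j) ^+ 2 < 1) /\
    forall j, j != i -> lor (e i) (e j) <= 0.
Proof.
move=> sys cP cox IR i; have [e1 hO Oe] := sys.
have [p [hp pi ps]] := IR i.
have wp : wall (cell e) (e i) p.
  by split=> //; split=> // j; have [->|/ps/ltW //] := eqVneq j i; rewrite pi.
(* Families of walls that suffice to cut the facet out of the plane of [e i]. In a minimal one,
   dropping a wall admits a point of the plane that violates this wall's inequality alone. *)
pose Q m (f : 'I_m -> 'I_n) := (forall j, f j != i) /\
  forall x, H3 x -> lor x (e i) = 0 -> (forall j, lor x (e (f j)) <= 0) -> cell e x.
have [|m [f [[fi fQ] fmin]]] := @minimal_family _ Q _ (lift i).
  split; first by move=> j; rewrite eq_sym neq_lift.
  move=> x hx xi h; split=> // j; case: (unliftP i j) => [k ->|->]; first exact: h.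
  by rewrite xi.
have fE j : lor (e i) (e (f j)) ^+ 2 < 1 /\ lor (e i) (e (f j)) <= 0.
  have [y [hy yi yj yl]] : exists y, [/\ H3 y, lor y (e i) = 0, 0 < lor y (e (f j)) &
      forall l, l != j -> lor y (e (f l)) <= 0].
    apply: contrapT => h; apply: (fmin j); split; first by move=> l; apply: fi.
    move=> x hx xi hl; apply: fQ => // l.
    case: (unliftP j l) => [k ->|->]; first exact: hl.
    rewrite leNgt; apply/negP => hj; apply: h; exists x; split=> // l' l'j.
    by case: (unliftP j l') l'j => [k ->|->]; rewrite ?eqxx // => _; exact: hl.
  have [|q [hq qi qj ql]] := @crossing_point m (e \o f) (e i) p y j hp hy pi yi _ yj yl.
    by move=> l; apply: ps; apply: fi.
  (* [u] is tangent to both planes, so a small move along it gives a second point of their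
     intersection. *)
  have [u u0 [uq ui uj]] := exists_orth3 q (e i) (e (f j)).
  have [|d d0 /(_ d)] := @cell_nbhd m (e \o f) q u hq.
    move=> l; have [->|/ql] := eqVneq l j; last by left.
    by right; rewrite /= qj uj.
  rewrite d0 lexx => /(_ isT)[ff fc]; have [c c0 hc] := hnorm_scale (proj1 ff).
  have cq : cell e q.
    by apply: fQ => // l; have [->|/ql/ltW//] := eqVneq l j; rewrite qj.
  have cq' : cell e (hnorm (q + d *: u)).
    apply: fQ; first exact: hnorm_H3.
      by rewrite hc !lorE qi ui; ring.
    by have [_ h] := cell_hnorm ff fc.
  have qq' : q <> hnorm (q + d *: u).
    move=> /(congr1 (fun z => lor z u)); rewrite hc /= !lorE (lorC q u) uq add0r => /esym/eqP.
    by rewrite !mulf_eq0 !gt_eqF //; apply: (lor_perp_gt0 (H3_lor_lt0_self hq)).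
  have eij : e i <> e (f j).
    by move=> eij; have := ps _ (fi j); rewrite -eij pi ltxx.
  have [|| g1 ed] := edge_wall (q := hnorm (q + d *: u)) sys eij qq'.
  - by split; split.
  - by split; split=> //; rewrite hc !lorE ?qi ?ui ?qj ?uj; ring.
  split=> //; have [pj [hpj pjj pjs]] := IR (f j).
  have [|k k2 ->] := coxeter_gram sys cox (facet_wall sys hp pi ps) (facet_wall sys hpj pjj pjs) _ ed g1.
    move=> /seteqP[/(_ p wp)[_ pfj] _].
    by have := ps _ (fi j); rewrite pfj ltxx.
  by rewrite oppr_le0 coxeter_gram_le0.
split.
  have [m0|m0] := posnP m; last by exists (f (Ordinal m0)); [exact: fi|have [] := fE (Ordinal m0)].
  exfalso.
  (* If no wall were needed, the whole plane would lie in the cell, and with it the ray from [p] in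
     the null direction [p + s u]. *)
  have [u u0 [up ui]] := exists_orth2 p (e i).
  have uu := lor_perp_gt0 (H3_lor_lt0_self hp) up u0.
  pose s := (Num.sqrt (lor u u))^-1.
  have ss : s ^+ 2 * lor u u = 1 by rewrite exprVn sqr_sqrtr ?mulVf ?gt_eqF // ltW.
  apply: (@compact_no_null_ray _ p (p + s *: u) cP hp).
  - by rewrite !lorE (proj1 hp) (lorC p u) up; move: ss; rewrite expr2; lra.
  - by rewrite !lorE (proj1 hp) up; lra.
  move=> t t0.
  have fut : future (p + t *: (p + s *: u)).
    apply: (future_inv (H3_future hp)); rewrite !lorE (proj1 hp) ?(lorC p u) up; last by lra.
    have h : t ^+ 2 * (s ^+ 2 * lor u u) = t ^+ 2 by rewrite ss mulr1.
    by move: h; rewrite !expr2; lra.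
  have [c c0 hc] := hnorm_scale (proj1 fut).
  apply: fQ; first exact: hnorm_H3.
    by rewrite hc !lorE pi ui; ring.
  by move=> j; have := leq_trans (ltn_ord j) (eq_leq m0).
move=> j ji; have [q [hq qj qs]] := IR j.
have fut := proj_future hq (e1 i).
have qi : lor q (e i) < 0 by apply: qs; rewrite eq_sym.
have [c c0 hc] := hnorm_scale (proj1 fut).
have [||] := fQ (hnorm (q - lor q (e i) *: e i)) (hnorm_H3 fut).
- by rewrite hc !lorE e1; ring.
- move=> l; rewrite hc lorE pmulr_rle0 // !lorE.
  have : lor q (e (f l)) <= 0 by have [->|/qs/ltW//] := eqVneq (f l) j; rewrite qj.
  by have [_] := fE l; nra.
move=> _ /(_ j); rewrite hc lorE pmulr_rle0 // !lorE qj.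
by nra.
Qed.

(** * Edges and vertices of acute-angled cells *)

Definition acute n (e : 'I_n -> vec) := forall i j, i != j -> lor (e i) (e j) <= 0.

(** Since the products of normals are nonpositive, the projection of [O] to the plane stays strictly
    inside the other half-spaces. *)
Lemma acute_facet n (e : 'I_n -> vec) O i : system e O -> acute e ->
  facet (cell e) (wall (cell e) (e i)).
Proof.
move=> sys ac; have [e1 hO Oe] := sys.
have fut := proj_future hO (e1 i).
have [c c0 hc] := hnorm_scale (proj1 fut).
apply: (facet_wall sys (hnorm_H3 fut)); rewrite hc.
  by rewrite !lorE e1; ring.
move=> j ji; rewrite lorE pmulr_rlt0 // !lorE.
have := Oe i; have := Oe j; have := ac i j; rewrite eq_sym ji => /(_ isT).
by nra.
Qed.

(* The square of the hyperbolic sine of the distance from [O] to the line orthogonal to [e] and [f]. *)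
Definition sinh2_line O e f : R :=
  (lor O e ^+ 2 + lor O f ^+ 2 - 2 * lor e f * lor O e * lor O f) / (1 - lor e f ^+ 2).

(** For unit normals, [O + line_coef O e f *: e + line_coef O f e *: f] is orthogonal to both [e]
    and [f]: the coefficients solve the 2 by 2 Gram system. *)
Definition line_coef O e f : R := - (lor O e - lor e f * lor O f) / (1 - lor e f ^+ 2).

(** [p] is the foot of [O] on the line and [N] the hyperbolic cosine of the distance. The
    unnormalised foot [r] differs from [O] by normals orthogonal to [r], whence [(r,r) = (r,O)]. *)
Lemma line_foot n (e : 'I_n -> vec) O i j : system e O -> acute e ->
  i != j -> lor (e i) (e j) ^+ 2 < 1 ->
  exists p N, [/\ H3 p, 0 < N, N ^+ 2 = 1 + sinh2_line O (e i) (e j),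
    lor p (e i) = 0 /\ lor p (e j) = 0 &
    forall k, N * lor p (e k) =
      lor O (e k) + line_coef O (e i) (e j) * lor (e i) (e k)
                  + line_coef O (e j) (e i) * lor (e j) (e k)].
Proof.
move=> [e1 hO Oe] ac ij g1.
have D0 : 1 - lor (e i) (e j) ^+ 2 != 0 by rewrite gt_eqF // subr_gt0.
pose r := O + line_coef O (e i) (e j) *: e i + line_coef O (e j) (e i) *: e j.
have ri : lor r (e i) = 0.
  by rewrite /r !lorE e1 /line_coef (lorC (e j)); field.
have rj : lor r (e j) = 0.
  by rewrite /r !lorE e1 /line_coef (lorC (e j) (e i)); field.
have rO : lor r O = - (1 + sinh2_line O (e i) (e j)).
  rewrite /r !lorE (proj1 hO) /line_coef /sinh2_line (lorC (e j) (e i)) !(lorC _ O); field; exact: D0.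
have rr : lor r r = lor r O.
  by rewrite {2}/r lorDr lorDr !lorZr ri rj; ring.
have s0 : 0 < sinh2_line O (e i) (e j).
  rewrite divr_gt0 ?subr_gt0 //; have := Oe i; have := Oe j; have := ac i j ij.
  set a := lor O _; set b := lor O _; set g := lor _ _ => g0 a0 b0.
  have : 0 <= - g * (a * b) by rewrite mulr_ge0 ?oppr_ge0 // nmulr_rge0 // ltW.
  by nra.
have fut : future r by apply: (future_inv (H3_future hO)); rewrite ?rr rO; lra.
have N2 : Num.sqrt (- lor r r) ^+ 2 = 1 + sinh2_line O (e i) (e j).
  by rewrite sqr_sqrtr rr rO opprK // addr_ge0 // ltW.
have N0 : 0 < Num.sqrt (- lor r r) by rewrite sqrtr_gt0 rr rO opprK addr_gt0.
exists (hnorm r), (Num.sqrt (- lor r r)); split=> //; first exact: hnorm_H3.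
  by rewrite /hnorm !lorZl ri rj mulr0.
move=> k; rewrite /hnorm lorZl mulrA divff ?gt_eqF // mul1r.
by rewrite /r !lorE.
Qed.

(** Both coefficients are nonnegative and the products of normals nonpositive, so the correction
    from [O] to the unnormalised foot does not increase the product with any other normal. *)
Lemma line_foot_lt0 n (e : 'I_n -> vec) O i j p N : system e O -> acute e ->
  i != j -> lor (e i) (e j) ^+ 2 < 1 -> 0 < N ->
  (forall k, N * lor p (e k) =
      lor O (e k) + line_coef O (e i) (e j) * lor (e i) (e k)
                  + line_coef O (e j) (e i) * lor (e j) (e k)) ->
  forall k, k != i -> k != j -> lor p (e k) < 0.
Proof.
move=> [e1 hO Oe] ac ij g1 N0 hk k ki kj; rewrite -(pmulr_rlt0 _ N0) hk.
have c1 a b g : a < 0 -> b < 0 -> g <= 0 -> 0 < 1 - g ^+ 2 ->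
  0 <= (- (a - g * b) / (1 - g ^+ 2) : R).
  by move=> a0 b0 g0 D0; rewrite divr_ge0 ?(ltW D0) //; nra.
have h1 : 0 <= line_coef O (e i) (e j) by apply: c1 => //; [exact: ac|rewrite subr_gt0].
have h2 : 0 <= line_coef O (e j) (e i).
  by apply: c1 => //; [apply: ac; rewrite eq_sym|rewrite subr_gt0 lorC].
have := ac i k; have := ac j k; rewrite !(eq_sym _ k) ki kj => /(_ isT) g2 /(_ isT) g3.
by have := Oe k; nra.
Qed.

(** The difference of the two sides is orthogonal to the basis [p], [u], [e], [f], hence zero. *)
Lemma indep_frame p u e f : H3 p -> lor u u = 1 -> lor u p = 0 ->
  lor p e = 0 -> lor p f = 0 -> lor u e = 0 -> lor u f = 0 ->
  lor e e = 1 -> lor f f = 1 -> lor e f ^+ 2 < 1 ->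
  forall x, lor x e = 0 -> lor x f = 0 -> x = - lor x p *: p + lor x u *: u.
Proof.
move=> hp uu up pe pf ue uf ee ff g1 x xe xf.
set r := x + lor x p *: p - lor x u *: u.
have rp : lor r p = 0 by rewrite /r !lorE up (proj1 hp); ring.
have ru : lor r u = 0 by rewrite /r !lorE (lorC p u) up uu; ring.
have re : lor r e = 0 by rewrite /r !lorE xe pe ue; ring.
have rf : lor r f = 0 by rewrite /r !lorE xf pf uf; ring.
suff : r = 0.
  move/eqP; rewrite /r subr_eq0 => /eqP h.
  by rewrite -h scaleNr [x + _]addrC addKr.
clearbody r; apply: contrapT => r0.
have rr := lor_perp_gt0 (H3_lor_lt0_self hp) rp r0.
pose f4 (i : 'I_4) := if i == 0 :> nat then p else if i == 1 :> nat then u else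
  if i == 2 :> nat then e else f.
have F4 : row_free (\matrix_(i < 4) f4 i).
  apply: row_freeE => c; rewrite mulmx_sum_row !big_ord_recl big_ord0 addr0 !rowK /f4 /=.
  set c0 := c _ _; set c1 := c _ _; set c2 := c _ _; set c3 := c _ _ => h.
  have := congr1 (fun z => lor z p) h; have := congr1 (fun z => lor z u) h.
  have := congr1 (fun z => lor z e) h; have := congr1 (fun z => lor z f) h.
  rewrite /= !lorE (proj1 hp) (lorC p u) (lorC e p) (lorC f p) (lorC e u) (lorC f u) (lorC f e).
  rewrite up pe pf ue uf uu ee ff; set g := lor e f in g1 *; rewrite !(mulr0, add0r, addr0, mulr1) => h3 h2 h1 h0.
  have n0 : 1 - g ^+ 2 != 0 by rewrite gt_eqF // subr_gt0.
  have c3E : c3 = 0.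
    apply/eqP; rewrite -[_ == 0]orbF -(negbTE n0) -mulf_eq0; apply/eqP.
    have -> : c3 * (1 - g ^+ 2) = (c2 * g + c3) - g * (c2 + c3 * g) by ring.
    by rewrite h3 h2; ring.
  have c2E : c2 = 0 by move: h2; rewrite c3E mul0r addr0.
  have c0E : c0 = 0 by lra.
  apply/rowP => i; rewrite mxE; case: (unliftP ord0 i) => [j ->|-> //].
  case: (unliftP ord0 j) => [k ->|-> //]; case: (unliftP ord0 k) => [l ->|-> //].
  by rewrite (ord1 l).
suff : (4 + 1 <= 4)%N by [].
apply: (@indep_orth 4 1 f4 (fun=> r) F4); last first.
  by move=> i _; rewrite lorC /f4; do ![case: ifP => // _].
apply: row_freeE => c; rewrite mulmx_sum_row big_ord1 rowK => /(congr1 (fun z => lor z r)) /=.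
rewrite !lorE => /eqP; rewrite mulf_eq0 (gt_eqF rr) orbF => /eqP h.
by apply/rowP => k; rewrite mxE (ord1 k).
Qed.

Lemma exists_argmax (T : finType) (A : pred T) (F : T -> R) k0 : A k0 ->
  exists2 k, A k & forall l, A l -> F l <= F k.
Proof. by move=> Ak0; case: (arg_maxP F Ak0) => k Ak h; exists k. Qed.

(** Moving from [p] along [u], the line leaves the cell at the first wall met, and by compactness
    this happens before the ideal point [p + u]. The inequality [- lor p (e k) < lor u (e k)]
    records the latter. *)
Lemma line_endpoint n (e : 'I_n -> vec) O i j p u : system e O ->
  compact (cell e) -> H3 p -> lor u u = 1 -> lor u p = 0 ->
  lor p (e i) = 0 -> lor p (e j) = 0 -> lor u (e i) = 0 -> lor u (e j) = 0 ->
  lor (e i) (e j) ^+ 2 < 1 ->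
  (forall k, k != i -> k != j -> lor p (e k) < 0) ->
  exists V k, [/\ k != i /\ k != j, - lor p (e k) < lor u (e k), 0 < lor V u,
    [/\ cell e V, lor V (e i) = 0, lor V (e j) = 0 & lor V (e k) = 0] & vertex (cell e) V].
Proof.
move=> [e1 hO Oe] cP hp uu up pi pj ui uj g1 pk.
have cp : cell e p.
  split=> // k; have [->|ki] := eqVneq k i; first by rewrite pi.
  by have [->|kj] := eqVneq k j; [rewrite pj|exact/ltW/pk].
have [k0] : exists k, 0 < lor (p + u) (e k).
  by apply: (cell_no_null cP cp); rewrite !lorE (proj1 hp) ?(lorC p u) up ?uu; lra.
rewrite lorE => hk0.
have k0i : k0 != i by apply: contraTneq hk0 => ->; rewrite pi ui addr0 ltxx.
have k0j : k0 != j by apply: contraTneq hk0 => ->; rewrite pj uj addr0 ltxx.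
(* The point [p + t u] reaches wall [k] when [t] is the inverse of this ratio, so the first wall met
   has the largest ratio. *)
have [|k /andP[ki kj] kmax] := @exists_argmax 'I_n (fun k => (k != i) && (k != j))
  (fun k => lor u (e k) / - lor p (e k)) k0; first by rewrite k0i.
have b0 := pk k ki kj; have sb : - lor p (e k) < lor u (e k).
  have := kmax k0; rewrite k0i k0j => /(_ isT) h.
  have h1 : 1 < lor u (e k0) / - lor p (e k0).
    by rewrite ltr_pdivlMr ?oppr_gt0 ?pk // mul1r; lra.
  by have := lt_le_trans h1 h; rewrite ltr_pdivlMr ?oppr_gt0 // mul1r.
have s0 : 0 < lor u (e k) by lra.
pose t := - lor p (e k) / lor u (e k).
have t0 : 0 < t by rewrite divr_gt0 ?oppr_gt0.
have t1 : t < 1 by rewrite ltr_pdivrMr // mul1r.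
have fut : future (p + t *: u).
  apply: (future_inv (H3_future hp)); rewrite !lorE (proj1 hp) ?(lorC p u) up ?uu; last by lra.
  by nra.
have [c c0 hc] := hnorm_scale (proj1 fut).
have Vi : lor (hnorm (p + t *: u)) (e i) = 0 by rewrite hc !lorE pi ui; ring.
have Vj : lor (hnorm (p + t *: u)) (e j) = 0 by rewrite hc !lorE pj uj; ring.
have Vk : lor (hnorm (p + t *: u)) (e k) = 0.
  by rewrite hc !lorE /t; field; rewrite gt_eqF.
have cV : cell e (hnorm (p + t *: u)).
  apply: cell_hnorm => // l; rewrite !lorE.
  have [->|li] := eqVneq l i; first by rewrite pi ui; lra.
  have [->|lj] := eqVneq l j; first by rewrite pj uj; lra.
  have := kmax l; rewrite li lj => /(_ isT); have := pk l li lj => bl.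
  rewrite ler_pdivrMr ?oppr_gt0 // => h.
  have : t * lor u (e l) <= t * (lor u (e k) / - lor p (e k) * - lor p (e l)).
    by rewrite ler_wpM2l // ltW.
  have -> : t * (lor u (e k) / - lor p (e k) * - lor p (e l)) = - lor p (e l).
    have n1 : lor u (e k) != 0 by rewrite gt_eqF.
    have n2 : lor p (e k) != 0 by rewrite lt_eqF.
    by rewrite /t; field; rewrite n1 n2.
  by lra.
exists (hnorm (p + t *: u)), k; split=> //.
  by rewrite hc !lorE (lorC p u) up uu mulr_gt0 //; lra.
set V := hnorm _ in cV Vi Vj Vk hc *.
have hV := proj1 cV.
(* As for edges, the sum of the normals supports the cell where all three products vanish; on the
   line this leaves a single point. *)
exists (e i + e j + e k); split.
  apply: (lor_perp_gt0 (H3_lor_lt0_self hV)); first by rewrite !lorDl !(lorC _ V) Vi Vj Vk; ring.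
  move=> /(congr1 (lor O)); rewrite lor0r !lorDr.
  by have := Oe i; have := Oe j; have := Oe k; lra.
split; first by move=> x [_ hx]; rewrite !lorDr; have := hx i; have := hx j; have := hx k; lra.
split; last by exists V.
apply/seteqP; split=> x /=.
  by move=> ->; rewrite !lorDr Vi Vj Vk; split=> //; ring.
move=> [[hx hxe]]; rewrite !lorDr => h.
have xi : lor x (e i) = 0 by have := hxe i; have := hxe j; have := hxe k; lra.
have xj : lor x (e j) = 0 by have := hxe i; have := hxe j; have := hxe k; lra.
have xk : lor x (e k) = 0 by have := hxe i; have := hxe j; have := hxe k; lra.
have xE := indep_frame hp uu up pi pj ui uj (e1 i) (e1 j) g1 xi xj.
have xu : lor x u = - lor x p * t.
  have := congr1 (fun z => lor z (e k)) xE; rewrite /= lorDl !lorZl xk => hk.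
  by rewrite /t; apply: (mulIf (_ : lor u (e k) != 0)); rewrite ?gt_eqF // mulrA divfK ?gt_eqF //; lra.
apply: (@H3_scale_eq _ _ (- lor x p / c)) => //.
rewrite hc scalerA divfK ?gt_eqF // scalerDr scalerA -xu.
exact: xE.
Qed.

Lemma dihedral_wall n (e : 'I_n -> vec) O i j : system e O ->
  dihedral (cell e) (wall (cell e) (e i)) (wall (cell e) (e j)) (acos (- lor (e i) (e j))).
Proof.
move=> [e1 hO Oe].
have on k : outward_normal (cell e) (wall (cell e) (e k)) (e k).
  by split=> //; split=> // x [_ h]; exact: h.
by exists (e i), (e j).
Qed.

Lemma acute_wall_neq n (e : 'I_n -> vec) O i j : system e O -> acute e -> i != j ->
  wall (cell e) (e i) <> wall (cell e) (e j).
Proof.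
move=> [e1 hO Oe] ac ij.
have fut := proj_future hO (e1 i); have [c c0 hc] := hnorm_scale (proj1 fut).
have neg k : k != i -> lor (O - lor O (e i) *: e i) (e k) < 0.
  move=> ki; rewrite !lorE; have := Oe i; have := Oe k.
  by have := ac i k; rewrite eq_sym ki => /(_ isT); nra.
have zi : lor (O - lor O (e i) *: e i) (e i) = 0 by rewrite !lorE e1; ring.
have cx : cell e (hnorm (O - lor O (e i) *: e i)).
  by apply: cell_hnorm => // k; have [->|/neg/ltW//] := eqVneq k i; rewrite zi.
move=> /seteqP[/(_ _ (conj cx _))[]]; first by rewrite hc lorE zi mulr0.
move=> _ /eqP; rewrite hc lorE mulf_eq0 gt_eqF //= lt_eqF //.
by apply: neg; rewrite eq_sym.
Qed.

(** The framing facets are found by moving from the foot [p] in the directions [u] and [-u]. The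
    last clause keeps the coordinates on which the width estimate rests. *)
Lemma ridge_at n (e : 'I_n -> vec) O i j : system e O -> acute e -> compact (cell e) ->
  i != j -> lor (e i) (e j) ^+ 2 < 1 ->
  let W k := wall (cell e) (e k) in
  let ang k l := acos (- lor (e k) (e l)) in
  exists k l V1 V2, [/\ uniq [:: i; j; k; l],
    [/\ lor (e i) (e k) ^+ 2 < 1, lor (e j) (e k) ^+ 2 < 1,
        lor (e i) (e l) ^+ 2 < 1 & lor (e j) (e l) ^+ 2 < 1],
    ridge (cell e) (W i `&` W j) V1 V2 (W i) (W j) (W k) (W l)
      (ang i j, ang i k, ang i l, ang j k, ang j l) &
    exists p u N, [/\ [/\ H3 p, lor u u = 1, lor u p = 0 & lor p (e i) = 0 /\ lor p (e j) = 0],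
      lor u (e i) = 0 /\ lor u (e j) = 0,
      lor u (e l) < lor p (e l) < 0 /\ lor p (e k) < 0 < lor p (e k) + lor u (e k),
      0 < N /\ N ^+ 2 = 1 + sinh2_line O (e i) (e j) &
      forall k, N * lor p (e k) =
      lor O (e k) + line_coef O (e i) (e j) * lor (e i) (e k)
                  + line_coef O (e j) (e i) * lor (e j) (e k)]].
Proof.
move=> sys ac cP ij g1 W ang; have [e1 hO Oe] := sys.
have [p [N [hp N0 N2 [pi pj] pk]]] := line_foot sys ac ij g1.
have plt := line_foot_lt0 sys ac ij g1 N0 pk.
have [u' u'0 [up' ui' uj']] := exists_orth3 p (e i) (e j).
have uu' := lor_perp_gt0 (H3_lor_lt0_self hp) up' u'0.
have [u [uu up ui uj]] : exists u,
    [/\ lor u u = 1, lor u p = 0, lor u (e i) = 0 & lor u (e j) = 0].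
  exists ((Num.sqrt (lor u' u'))^-1 *: u'); rewrite !lorE up' ui' uj' !mulr0; split=> //.
  rewrite mulrA -expr2 exprVn sqr_sqrtr ?mulVf ?gt_eqF //; exact: ltW.
have [V1 [k [[ki kj] sk V1u [cV1 V1i V1j V1k] vV1]]] :=
  line_endpoint sys cP hp uu up pi pj ui uj g1 plt.
have [||||V2 [l [[li lj] sl V2u [cV2 V2i V2j V2l] vV2]]] :=
  @line_endpoint n e O i j p (- u) sys cP hp _ _ pi pj _ _ g1 plt.
- by rewrite !lorE uu; ring.
- by rewrite lorE up oppr0.
- by rewrite lorE ui oppr0.
- by rewrite lorE uj oppr0.
move: sl V2u; rewrite !lorE => sl V2u.
have pk0 := plt k ki kj; have pl0 := plt l li lj.
(* The product of [u] is positive with [e k] and negative with [e l]. *)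
have kl : k != l by apply: contraTneq sk => ->; rewrite -leNgt; lra.
have cp : cell e p.
  split=> // m; have [->|mi] := eqVneq m i; first by rewrite pi.
  by have [->|mj] := eqVneq m j; [rewrite pj|exact/ltW/plt].
have ne a b : a != b -> e a <> e b.
  by move=> ab E; have := ac a b ab; rewrite E e1; lra.
have gV V a b : cell e V -> a != b -> lor V (e a) = 0 -> lor V (e b) = 0 -> lor (e a) (e b) ^+ 2 < 1.
  move=> cV ab Va Vb.
  by apply: (gram_lt1 (H3_lor_lt0_self (proj1 cV)) Va Vb) => //; exact: ne.
have pV1 : p <> V1 by move=> E; move: V1u; rewrite -E lorC up ltxx.
have V12 : V1 <> V2 by move=> E; move: V1u V2u; rewrite E; lra.
have [_ edg] := edge_wall sys (ne _ _ ij) pV1 (conj (conj cp pi) (conj cp pj))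
  (conj (conj cV1 V1i) (conj cV1 V1j)).
exists k, l, V1, V2; split; last first.
- by exists p, u, N; split=> //; split; apply/andP; split=> //; lra.
- have fac m : facet (cell e) (W m) by exact: (acute_facet _ sys ac).
  have dih a b : dihedral (cell e) (W a) (W b) (ang a b) by exact: (dihedral_wall _ _ sys).
  have nsub m : lor p (e m) < 0 -> ~ (W i `&` W j `<=` W m).
    by move=> pm /(_ p (conj (conj cp pi) (conj cp pj)))[_ pm0]; move: pm; rewrite pm0 ltxx.
  have nij := acute_wall_neq sys ac ij.
  rewrite /ridge; split=> //; split=> //; split=> //; split=> //.
  split; first exact: (conj (conj cV1 V1i) (conj cV1 V1j)).
  split; first exact: (conj (conj cV2 V2i) (conj cV2 V2j)).
  split=> //; split=> //; split=> //; split; first by move=> x [].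
  split; first by move=> x [].
  split=> //; split; first exact: (conj cV1 V1k).
  split; first exact: (nsub _ pk0).
  split=> //; split; first exact: (conj cV2 V2l).
  by split; first exact: (nsub _ pl0).
- by split; [apply: (gV V1)|apply: (gV V1)|apply: (gV V2)|apply: (gV V2)] => //; rewrite eq_sym.
- by rewrite /= !inE !negb_or ij !(eq_sym i) !(eq_sym j) ki kj li lj kl.
Qed.

(** * Hyperbolic distance and the width of a ridge *)

Lemma acosh1 : acosh 1 = 0.
Proof. by rewrite /acosh expr1n subrr sqrtr0 addr0 ln1. Qed.

Lemma acosh_arg_ge1 (z : R) : 1 <= z -> 1 <= z + Num.sqrt (z ^+ 2 - 1).
Proof. by move=> z1; apply: le_trans z1 _; rewrite lerDl sqrtr_ge0. Qed.

Lemma acosh_ge0 z : 1 <= z -> 0 <= acosh z.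
Proof. by move=> /acosh_arg_ge1 h; rewrite ln_ge0. Qed.

Lemma acosh_le z w : 1 <= z -> z <= w -> acosh z <= acosh w.
Proof.
move=> z1 zw; have w1 := le_trans z1 zw.
rewrite /acosh ler_ln ?posrE; first last.
- by apply: lt_le_trans (acosh_arg_ge1 w1).
- by apply: lt_le_trans (acosh_arg_ge1 z1).
rewrite lerD // ler_wsqrtr // lerB // ler_sqr ?nnegrE //; lra.
Qed.

Lemma coshK z : 1 <= z -> cosh (acosh z) = z.
Proof.
move=> z1; have h1 := acosh_arg_ge1 z1.
have s2 : Num.sqrt (z ^+ 2 - 1) ^+ 2 = z ^+ 2 - 1.
  by rewrite sqr_sqrtr // subr_ge0 expr_ge1 //; lra.
rewrite /cosh expRN /acosh lnK ?posrE; last by lra.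
move: h1 s2; set s := Num.sqrt _ => h1 s2.
have -> : (z + s)^-1 = z - s.
  apply: (mulIf (_ : z + s != 0)); first by rewrite gt_eqF //; lra.
  by rewrite mulVf ?gt_eqF //; lra.
by field.
Qed.

Lemma cosh_le a b : 0 <= a -> a <= b -> cosh a <= cosh b.
Proof.
move=> a0 ab; rewrite /cosh ler_wpM2r ?invr_ge0 //.
rewrite !expRN.
have A1 : 1 <= expR a by have := ler_expR 0 a; rewrite exp.expR0 a0 => ->.
have AB : expR a <= expR b by rewrite ler_expR.
move: A1 AB; set x := expR a; set y := expR b => x1 xy.
rewrite -subr_ge0; have -> : y + y^-1 - (x + x^-1) = (y - x) * (x * y - 1) / (x * y).
  by field; rewrite !gt_eqF //; lra.
by rewrite divr_ge0 ?mulr_ge0 //; nra.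
Qed.

Lemma hdist_ge0 x y : H3 x -> H3 y -> 0 <= hdist x y.
Proof. by move=> hx hy; apply: acosh_ge0; have := H3_lor_leN1 hx hy; lra. Qed.

Lemma width_le_cosh (A B : set vec) x y : A `<=` H3 -> B `<=` H3 -> A x -> B y ->
  width A B <= - lor x y.
Proof.
move=> AH BH Ax By; have xy := H3_lor_leN1 (AH _ Ax) (BH _ By).
have lb : lbound [set hdist a b | a in A & b in B] 0.
  by move=> _ [a Aa [b Bb <-]]; apply: hdist_ge0; [exact: AH|exact: BH].
rewrite /width -[leRHS]coshK; last by lra.
apply: cosh_le.
  by apply: lb_le_inf => //; exists (hdist x y), x => //; exists y.
by apply: ge_inf; [exists 0|exists x => //; exists y].
Qed.

Lemma width_wall n (e : 'I_n -> vec) O k l : system e O -> acute e -> compact (cell e) ->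
  k != l -> width (wall (cell e) (e k)) (wall (cell e) (e l)) <= Num.max 1 (- lor (e k) (e l)).
Proof.
move=> sys ac cP kl; have [e1 hO Oe] := sys.
have sub m : wall (cell e) (e m) `<=` H3 by move=> x [[]].
have g0 := ac k l kl.
have [gN|gN|gE] := ltgtP (lor (e k) (e l)) (-1).
- (* the feet of the common perpendicular of the two planes lie in the two facets *)
  set g := lor _ _ in g0 gN *.
  have foot a b : a != b -> lor (e a) (e b) = g -> exists2 c, 0 < c &
      wall (cell e) (e a) (c *: (e b - g *: e a)) /\ c ^+ 2 * (g ^+ 2 - 1) = 1.
    move=> ab gab; have fut : future (e b - g *: e a).
      apply: (future_inv (H3_future hO)); rewrite !lorE ?e1 ?(lorC (e b) (e a)) ?gab; first by nra.
      by rewrite !(lorC _ O); have := Oe a; have := Oe b; nra.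
    have [c c0 hc] := hnorm_scale (proj1 fut).
    have za : lor (e b - g *: e a) (e a) = 0 by rewrite !lorE e1 (lorC (e b)) gab; ring.
    exists c => //; rewrite -hc; split.
      split; last by rewrite hc lorE za mulr0.
      apply: cell_hnorm => // m; have [->|ma] := eqVneq m a; first by rewrite za.
      rewrite !lorE; have := ac a m; rewrite eq_sym ma => /(_ isT).
      have [->|mb] := eqVneq m b; first by rewrite e1 gab; nra.
      by have := ac b m; rewrite eq_sym mb => /(_ isT); nra.
    have := proj1 (hnorm_H3 fut); rewrite hc !lorE !e1 (lorC (e b)) gab; lra.
  have [c c0 [wc c2]] := foot k l kl erefl.
  have [|d d0 [wd d2]] := foot l k _ (lorC _ _); first by rewrite eq_sym.
  have cd : c = d.
    by apply/eqP; rewrite -(eqrXn2 (_ : 0 < 2)%N) ?ltW //; apply/eqP; nra.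
  apply: le_trans (width_le_cosh (sub k) (sub l) wc wd) _.
  rewrite -cd !lorE !e1 (lorC (e l) (e k)) -/g le_max; apply/orP; right.
  apply: (@le_trans _ _ (- g * (c ^+ 2 * (g ^+ 2 - 1)))); last by rewrite c2 mulr1.
  by rewrite le_eqVlt; apply/orP; left; apply/eqP; ring.
- (* the two planes meet, hence so do the two facets *)
  have g1 : lor (e k) (e l) ^+ 2 < 1 by nra.
  have [p [N [hp N0 N2 [pk pl] hpm]]] := line_foot sys ac kl g1.
  have plt := line_foot_lt0 sys ac kl g1 N0 hpm.
  have cp : cell e p.
    split=> // m; have [->|mk] := eqVneq m k; first by rewrite pk.
    by have [->|ml] := eqVneq m l; [rewrite pl|exact/ltW/plt].
  apply: le_trans (width_le_cosh (sub k) (sub l) (conj cp pk) (conj cp pl)) _.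
  by rewrite (proj1 hp) opprK le_max lexx.
(* Tangent planes: [e k + e l] is null and would be an ideal point of the cell. *)
have cO : cell e O by split=> // m; exact/ltW.
have [||m] := @cell_no_null n e O (e k + e l) cP cO.
- by rewrite !lorE !e1 (lorC (e l)) gE; ring.
- by rewrite !lorE !(lorC _ O); have := Oe k; have := Oe l; lra.
rewrite lorE; have [->|mk] := eqVneq m k; first by rewrite e1 (lorC (e l)) gE; lra.
have [->|ml] := eqVneq m l; first by rewrite e1 gE; lra.
by have := ac k m; have := ac l m; rewrite !(eq_sym _ m) mk ml => /(_ isT) h1 /(_ isT) h2; lra.
Qed.

(** Orthogonal decomposition along [p], [u] and the span of [e], [f]; the fraction comes from the
    inverse Gram matrix of [e] and [f]. *)
Lemma frame_gram p u e f : H3 p -> lor u u = 1 -> lor u p = 0 ->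
  lor p e = 0 -> lor p f = 0 -> lor u e = 0 -> lor u f = 0 ->
  lor e e = 1 -> lor f f = 1 -> lor e f ^+ 2 < 1 ->
  forall x y, lor x y = - (lor p x * lor p y) + lor u x * lor u y +
    (lor e x * lor e y + lor f x * lor f y - lor e f * (lor e x * lor f y + lor f x * lor e y))
      / (1 - lor e f ^+ 2).
Proof.
move=> hp uu up pe pf ue uf ee ff g1 x y.
have D0 : 1 - lor e f ^+ 2 != 0 by rewrite gt_eqF // subr_gt0.
pose A z := (lor e z - lor e f * lor f z) / (1 - lor e f ^+ 2).
pose B z := (lor f z - lor e f * lor e z) / (1 - lor e f ^+ 2).
pose r z := z - A z *: e - B z *: f.
have re z : lor (r z) e = 0.
  by rewrite /r /A /B !lorE ee (lorC f e) (lorC z e); field.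
have rf z : lor (r z) f = 0.
  by rewrite /r /A /B !lorE ff (lorC z f); field.
have rp z : lor (r z) p = lor p z by rewrite /r !lorE (lorC e p) (lorC f p) pe pf (lorC z); ring.
have ru z : lor (r z) u = lor u z by rewrite /r !lorE (lorC e u) (lorC f u) ue uf (lorC z); ring.
have rE z := indep_frame hp uu up pe pf ue uf ee ff g1 (re z) (rf z).
have : lor (r x) (r y) = - (lor p x * lor p y) + lor u x * lor u y.
  by rewrite [r y]rE !(lorDr, lorZr) !rp !ru; ring.
rewrite {2}/r !(lorDr, lorZr, lorNr) re rf /r !(lorDl, lorZl, lorNl) => <-.
by rewrite /A /B; field.
Qed.

(** * From a Coxeter polytope to an acute family of normals *)

Lemma acosh_cosh t : 0 <= t -> acosh (cosh t) = t.
Proof.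
move=> t0; rewrite /acosh /cosh expRN; have e0 := expR_gt0 t.
have e1 : 1 <= expR t by have := ler_expR 0 t; rewrite exp.expR0 t0 => ->.
set x := expR t in e0 e1 *.
have x1 : x^-1 <= 1 by rewrite invf_le1.
have -> : ((x + x^-1) / 2) ^+ 2 - 1 = ((x - x^-1) / 2) ^+ 2 by field; rewrite gt_eqF.
rewrite sqrtr_sqr ger0_norm; last by lra.
by have -> : (x + x^-1) / 2 + (x - x^-1) / 2 = x; [field; rewrite gt_eqF|rewrite expRK].
Qed.

(** Otherwise [x] lies on the plane, and the point [cosh t x + sinh t e] at distance [t = r / 2] is
    in the ball but on the wrong side. *)
Lemma interior_strict (P : set vec) x r e : H3 x -> 0 < r ->
  (forall y, H3 y -> hdist x y < r -> P y) -> lor e e = 1 -> (forall y, P y -> lor y e <= 0) ->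
  lor x e < 0.
Proof.
move=> hx r0 ball ee hP.
have xP : lor x e <= 0 by apply: hP; apply: ball => //; rewrite /hdist (proj1 hx) opprK acosh1.
rewrite lt_neqAle xP andbT; apply/eqP => xe.
pose t : R := r / 2; have t0 : 0 < t by rewrite divr_gt0.
have e1 : 1 < expR t by have := ltr_expR 0 t; rewrite exp.expR0 t0 => ->.
have x1 : (expR t)^-1 < 1 by rewrite invf_lt1 // expR_gt0.
pose C := cosh t; pose S := (expR t - (expR t)^-1) / 2.
have CS : C ^+ 2 - S ^+ 2 = 1.
  by rewrite /C /S /cosh expRN; field; rewrite gt_eqF // expR_gt0.
have S0 : 0 < S by rewrite divr_gt0 ?subr_gt0 // (lt_trans x1).
have C0 : 0 < C by rewrite /C /cosh expRN divr_gt0 // addr_gt0 ?invr_gt0 ?expR_gt0.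
pose y := C *: x + S *: e.
have yx : lor y x = - C by rewrite /y !lorE (proj1 hx) (lorC e) xe; ring.
have yy : lor y y = -1.
  by rewrite /y !lorE (proj1 hx) (lorC e x) xe ee; move: CS; rewrite !expr2; lra.
have hy : H3 y.
  by split=> //; apply: (proj2 (future_inv (H3_future hx) _ _)); rewrite ?yy ?yx; lra.
have := hP y; have : P y.
  apply: ball => //; rewrite /hdist lorC yx opprK acosh_cosh; last exact: ltW.
  by rewrite /t ltr_pdivrMr // ltr_pMr // ltr1n.
by move=> Py /(_ Py); rewrite /y !lorE xe ee; lra.
Qed.

(** The centre of the ball in the definition of a polytope serves as [O]. Minimality of the family
    of unit normals gives each wall a point strictly inside the other half-spaces, as [nonobtuse]
    demands. *)
Lemma coxeter_acute (P : set vec) : compact_coxeter_polytope P ->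
  exists n (e : 'I_n -> vec) O, [/\ P = cell e, system e O, acute e &
    exists i j, i != j /\ lor (e i) (e j) ^+ 2 < 1].
Proof.
move=> [cox cP]; have [[[n0 [e0 [hs0 PE]]] [ O [PO [r [r0 ball]]]]] _] := cox.
pose Q m (f : 'I_m -> vec) := (forall i, lor (f i) (f i) = 1) /\ P = cell f.
have [|n [e [[e1 PE'] emin]]] :=
    @minimal_family _ Q n0 (fun i => (Num.sqrt (lor (e0 i) (e0 i)))^-1 *: e0 i).
  have s0 i : 0 < Num.sqrt (lor (e0 i) (e0 i)) by rewrite sqrtr_gt0.
  split; first by move=> i; rewrite !lorE mulrA -expr2 exprVn sqr_sqrtr ?mulVf ?gt_eqF // ltW.
  rewrite PE; apply/seteqP; split=> x [hx h]; split=> // i; have := h i.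
    by rewrite lorE pmulr_rle0 // invr_gt0.
  by rewrite lorE pmulr_rle0 // invr_gt0.
have hO : H3 O by move: PO; rewrite PE'; case.
have Oe i : lor O (e i) < 0.
  by apply: (interior_strict hO r0 ball (e1 i)) => y; rewrite PE'; case.
have sys : system e O by [].
have IR i : exists p, [/\ H3 p, lor p (e i) = 0 & forall j, j != i -> lor p (e j) < 0].
  have [y [hy yi yj]] : exists y, [/\ H3 y, 0 < lor y (e i) & forall j, j != i -> lor y (e j) <= 0].
    apply: contrapT => h; apply: (emin i); split=> //=.
    rewrite PE'; apply/seteqP; split=> x [hx hl]; split=> // l; first exact: hl.
    case: (unliftP i l) => [k ->|->]; first exact: hl.
    rewrite leNgt; apply/negP => xi; apply: h; exists x; split=> // j.
    by case: (unliftP i j) => [k ->|->]; rewrite ?eqxx // => _; exact: hl.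
  (* With [w = 0] the crossing takes place in the whole space rather than in a plane. *)
  have [p [hp _ pi ps]] := crossing_point hO hy (lor0r O) (lor0r y) Oe yi yj.
  by exists p.
rewrite PE' in cP cox.
have main := nonobtuse sys cP cox IR.
exists n, e, O; split=> //; first by move=> i j ij; apply: (main i).2; rewrite eq_sym.
have [n_0|n_0] := posnP n; last first.
  by have [[j ji g1] _] := main (Ordinal n_0); exists (Ordinal n_0), j; rewrite eq_sym.
(* Without normals the cell is all of [H3], which contains a null ray. *)
exfalso; have [u u0 uO] := exists_orth1 O.
have uu := lor_perp_gt0 (H3_lor_lt0_self hO) uO u0.
have [v [vv vO]] : exists v, lor v v = 0 /\ lor v O = -1.
  exists (O + (Num.sqrt (lor u u))^-1 *: u); rewrite !lorE (proj1 hO) (lorC O u) uO; split; last by ring.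
  have : (Num.sqrt (lor u u))^-1 ^+ 2 * lor u u = 1 by rewrite exprVn sqr_sqrtr ?mulVf ?gt_eqF // ltW.
  by rewrite expr2; lra.
apply: (compact_no_null_ray cP hO vv) => [|t t0]; first by rewrite vO; lra.
split; last by move=> i; have := leq_trans (ltn_ord i) (eq_leq n_0).
apply: hnorm_H3; apply: (future_inv (H3_future hO)); rewrite !lorE ?vv ?(lorC O v) vO (proj1 hO); lra.
Qed.

Lemma acute_gram n (e : 'I_n -> vec) O i j : system e O -> acute e -> compact (cell e) ->
  coxeter_polytope (cell e) -> i != j -> lor (e i) (e j) ^+ 2 < 1 ->
  exists2 k : nat, (2 <= k)%N & lor (e i) (e j) = - cos (pi / k%:R).
Proof.
move=> sys ac cP cox ij g1; have [k [l [V1 [V2 [_ _ [ed _] _]]]]] := ridge_at sys ac cP ij g1.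
exact: (coxeter_gram sys cox (acute_facet _ sys ac) (acute_facet _ sys ac) (acute_wall_neq sys ac ij) ed g1).
Qed.

(** * Cosines of the angles pi/k *)

Lemma cos_antitone (x y : R) : 0 <= x -> x <= y -> y <= pi / 2 -> cos y <= cos x.
Proof.
move=> x0 xy y2; have pi0 : 0 <= pi / 2 :> R by rewrite divr_ge0 ?pi_ge0.
have pi1 : pi = pi / 2 + pi / 2 :> R by lra.
by rewrite leNgt ltr_cos ?in_itv /= ?x0 -?leNgt //; apply/andP; split; lra.
Qed.

Lemma cos3 (x : R) : cos (3 * x) = 4 * cos x ^+ 3 - 3 * cos x.
Proof.
have -> : 3 * x = x *+ 2 + x by rewrite mulr2n; ring.
rewrite trigo.cosD cos_mulr2n sin_mulr2n !mulr2n.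
have := cos2Dsin2 x; set c := cos x; set s := sin x => h.
have -> : (c ^+ 2 + c ^+ 2 - 1) * c - (c * s + c * s) * s = 2 * c ^+ 3 - c - 2 * c * s ^+ 2 by ring.
have -> : s ^+ 2 = 1 - c ^+ 2 by lra.
by ring.
Qed.

Lemma cos2 (x : R) : cos (2 * x) = 2 * cos x ^+ 2 - 1.
Proof.
have -> : 2 * x = x *+ 2 by rewrite mulr2n; ring.
by rewrite cos_mulr2n mulr2n; ring.
Qed.

Lemma cos_pi_gt0 (k : nat) : (2 < k)%N -> 0 < cos ((pi : R) / k%:R).
Proof.
move=> k2; have k0 : 0 < k%:R :> R by rewrite ltr0n; apply: leq_trans k2.
apply: cos_gt0_pihalf; apply/andP; split.
  by apply: (@lt_trans _ _ 0); rewrite ?oppr_lt0 divr_gt0 ?pi_gt0.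
by rewrite ltr_pM2l ?pi_gt0 // ltf_pV2 ?posrE // ltr_nat.
Qed.

Lemma cos_pi3 : cos ((pi : R) / 3) = 1 / 2.
Proof.
have := cos_pi_gt0 (isT : (2 < 3)%N); have := cos3 (pi / 3).
have -> : 3 * (pi / 3) = pi :> R by field.
rewrite cospi; set c := cos _ => h c0.
have : (c + 1) * (2 * c - 1) ^+ 2 = 0 by move: h; rewrite !exprS expr0; lra.
move=> /eqP; rewrite mulf_eq0 gt_eqF /=; last by lra.
by rewrite sqrf_eq0 => /eqP; lra.
Qed.

Lemma cos_pi4 : cos ((pi : R) / 4) ^+ 2 = 1 / 2.
Proof.
have := cos2 (pi / 4); have -> : 2 * (pi / 4) = pi / 2 :> R by field.
by rewrite cos_pihalf; lra.
Qed.

(** At this angle [cos (3 x) = - cos (2 x)], a cubic equation in the cosine, whose root -1 is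
    discarded. *)
Lemma cos_pi5 : 4 * cos ((pi : R) / 5) ^+ 2 = 2 * cos (pi / 5) + 1.
Proof.
have := cos_pi_gt0 (isT : (2 < 5)%N); have := cos3 (pi / 5); have := cos2 (pi / 5).
have : cos (3 * (pi / 5)) = - cos (2 * (pi / 5) : R).
  have -> : 3 * (pi / 5) = pi - 2 * (pi / 5) :> R by field.
  by rewrite trigo.cosB cospi sinpi; ring.
move=> -> ->; set c := cos _ => h c0.
have : (c + 1) * (4 * c ^+ 2 - 2 * c - 1) = 0 by move: h; rewrite !exprS expr0; lra.
move=> /eqP; rewrite mulf_eq0 gt_eqF /=; last by lra.
by move=> /eqP; lra.
Qed.

Lemma cos_pi6 : cos ((pi : R) / 6) ^+ 2 = 3 / 4.
Proof.
have := cos_pi_gt0 (isT : (2 < 6)%N); have := cos3 (pi / 6).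
have -> : 3 * (pi / 6) = pi / 2 :> R by field.
rewrite cos_pihalf; set c := cos _ => h c0.
have : c * (4 * c ^+ 2 - 3) = 0 by move: h; rewrite !exprS expr0; lra.
by move=> /eqP; rewrite mulf_eq0 gt_eqF //= => /eqP; lra.
Qed.

Lemma cos_pi_mono (k l : nat) : (2 <= k)%N -> (k <= l)%N ->
  cos ((pi : R) / k%:R) <= cos ((pi : R) / l%:R).
Proof.
move=> k2 kl; have /andP[_ h1] := angle_bounds k2.
have /andP[h2 _] := angle_bounds (leq_trans k2 kl).
apply: cos_antitone => //.
have k0 : (0 < k)%N by apply: leq_trans k2.
by rewrite ler_wpM2l ?pi_ge0 // lef_pV2 ?posrE ?ltr0n ?ler_nat // (leq_trans k0).
Qed.

(** What the estimate needs of a cosine of [pi / k]: the exact values for [k] equal to 2 and 3, a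
    lower bound from 4 on, and the gap between 5 and 6. The number [17 / 21] is slightly above
    [cos (pi / 5)]. *)
Definition angle_cos (c : R) := [/\ 0 <= c, c = 0 \/ c = 1 / 2 \/ 1 / 2 <= c ^+ 2 &
  c <= 17 / 21 \/ 3 / 4 <= c ^+ 2].

Lemma angle_cos_pi (k : nat) : (2 <= k)%N -> angle_cos (cos ((pi : R) / k%:R)).
Proof.
move=> k2; set c := cos _; have c0 : 0 <= c by exact: coxeter_gram_le0.
have c5 : cos ((pi : R) / 5) <= 17 / 21 by have := cos_pi5; nra.
split=> //.
- case: k k2 @c c0 => [|[|[|[|k]]]] // _ c c0; first by left; rewrite /c cos_pihalf.
    by right; left; exact: cos_pi3.
  right; right; rewrite -cos_pi4 ler_sqr ?nnegrE //; last exact: (@coxeter_gram_le0 4).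
  exact: (@cos_pi_mono 4).
- have [k5|k5] := leqP k 5; first by left; apply: le_trans c5; exact: (@cos_pi_mono k 5).
  right; rewrite -cos_pi6 ler_sqr ?nnegrE //; last exact: (@coxeter_gram_le0 6).
  exact: (@cos_pi_mono 6).
Qed.

(** * The width estimate *)

(** The case of a right angle between F_2 and F_3, up to exchanging F_1 and F_2. Here [c] and [a]
    are the cosines of the angles of F_1 with F_2 and F_3, [1 / t] is the sine of the first, [k1],
    [k2], [k3] are the [-(O,e_i)] divided by [N], [q] is the squared hyperbolic tangent of the
    distance from [O] to the edge, and [y = -(e_3,p)]. *)
Lemma vertex_bound_side (a c t k1 k2 k3 q y : R) : angle_cos a -> angle_cos c ->
  1 / 2 <= c -> 0 < t -> t ^+ 2 * (1 - c ^+ 2) = 1 -> q <= 1 ->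
  0 <= k1 -> 0 <= k2 -> 0 <= k3 -> a != 0 ->
  a ^+ 2 + c ^+ 2 < 1 ->
  (1 - c ^+ 2) * q = k1 ^+ 2 + k2 ^+ 2 + 2 * c * k1 * k2 ->
  k1 ^+ 2 + k3 ^+ 2 + 2 * a * k1 * k3 <= (1 - a ^+ 2) * q ->
  y = k3 + t ^+ 2 * ((k1 + c * k2) * a) ->
  (a = 1 / 2 /\ y <= 13 / 15 + t / 2) \/
  (c = 1 / 2 /\ y ^+ 2 - a ^+ 2 * t ^+ 2 / 2 <= 11 / 5).
Proof.
move=> [a0 av _] [c0 cv _] c2 t0 tc q1 k10 k20 k30 na ac eq1 le3 yE.
have ha : 1 / 2 <= a by move: av => [/eqP|[->//|]]; [rewrite (negbTE na)|nra].
have s2 : 0 < 1 - c ^+ 2 by nra.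
have a1 : 0 < 1 - a ^+ 2 by nra.
have q0 : 0 <= q.
  rewrite -(pmulr_rge0 _ s2) eq1 addr_ge0 ?addr_ge0 ?sqr_ge0 // !mulr_ge0 //; lra.
have hk3 : k3 ^+ 2 <= 1 - a ^+ 2.
  have : 0 <= 2 * a * k1 * k3 by rewrite !mulr_ge0.
  have := sqr_ge0 k1; have : (1 - a ^+ 2) * q <= 1 - a ^+ 2 by rewrite ler_piMr // ltW.
  by lra.
have m0 : 0 <= k1 + c * k2 by rewrite addr_ge0 // mulr_ge0.
(* [eq1] reads [(k1 + c k2)^2 + (1 - c^2) k2^2 = (1 - c^2) q]. *)
have hm : t * (k1 + c * k2) <= 1.
  suff : (t * (k1 + c * k2)) ^+ 2 <= 1 ^+ 2.
    by rewrite ler_sqr ?nnegrE // mulr_ge0 // ltW.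
  rewrite expr1n exprMn -[leRHS]tc ler_wpM2l ?sqr_ge0 //.
  have : (1 - c ^+ 2) * q <= 1 - c ^+ 2 by rewrite ler_piMr // ltW.
  have : 0 <= k2 ^+ 2 * (1 - c ^+ 2) by rewrite mulr_ge0 ?sqr_ge0 // ltW.
  by rewrite eq1; lra.
have yle : y <= k3 + a * t.
  rewrite yE lerD2l; have -> : t ^+ 2 * ((k1 + c * k2) * a) = a * t * (t * (k1 + c * k2)) by ring.
  by rewrite ler_piMr // mulr_ge0 // ltW.
have y0 : 0 <= y by rewrite yE addr_ge0 // !mulr_ge0 // ltW.
case: av => [/eqP|[ae|a2]]; first by rewrite (negbTE na).
  left; split=> //; apply: le_trans yle _; rewrite ae.
  have : k3 <= 13 / 15 by rewrite ae in hk3; nra.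
  by lra.
(* Since [a^2 >= 1/2], the condition [a^2 + c^2 < 1] leaves only [c = 1/2], so that [t^2 = 4/3]. *)
right; have cE : c = 1 / 2 by clear -cv c2 ac a2; move: cv => [|[]]; lra.
split=> //; have tE : t ^+ 2 = 4 / 3 by rewrite cE in tc; lra.
have tle : t <= 22 / 19 by nra.
have ka : k3 * a <= 1 / 2 by clear -hk3; have := sqr_ge0 (k3 - a); lra.
have y2 : y ^+ 2 <= (k3 + a * t) ^+ 2 by rewrite ler_sqr // nnegrE (le_trans y0).
have e2 : (k3 + a * t) ^+ 2 = k3 ^+ 2 + 2 * (k3 * a) * t + a ^+ 2 * t ^+ 2 by ring.
have kat : k3 * a * t <= 1 / 2 * t by rewrite ler_pM2r.
rewrite tE in e2 *; clear -y2 e2 kat tle ka hk3 a2.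
by lra.
Qed.

(** This is [y^2 - |X|^2 / 2] with [X] the component of e_3 (or e_4) in the span of e_1 and e_2. *)
Definition vertex_excess (a b c t y : R) := y ^+ 2 - (a ^+ 2 + b ^+ 2 + 2 * a * b * c) * t ^+ 2 / 2.

(** Positivity of the Gram determinant of the three normals at the vertex forces one cosine to
    vanish. For [c = 0] Cauchy-Schwarz gives [y^2 <= 1]; for [a = b = 0] one has [y = k3]; otherwise
    [vertex_bound_side] applies to the nonzero one of [a], [b]. *)
Lemma vertex_bound (a b c t k1 k2 k3 q y : R) : angle_cos a -> angle_cos b -> angle_cos c ->
  0 < t -> t ^+ 2 * (1 - c ^+ 2) = 1 -> q <= 1 ->
  0 <= k1 -> 0 <= k2 -> 0 <= k3 ->
  a ^+ 2 + b ^+ 2 + c ^+ 2 + 2 * a * b * c < 1 ->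
  (1 - c ^+ 2) * q = k1 ^+ 2 + k2 ^+ 2 + 2 * c * k1 * k2 ->
  k1 ^+ 2 + k3 ^+ 2 + 2 * a * k1 * k3 <= (1 - a ^+ 2) * q ->
  k2 ^+ 2 + k3 ^+ 2 + 2 * b * k2 * k3 <= (1 - b ^+ 2) * q ->
  y = k3 + t ^+ 2 * ((k1 + c * k2) * a + (k2 + c * k1) * b) ->
  0 <= y /\ [\/ y ^+ 2 <= 1,
    [/\ 1 / 2 <= c, (a = 1 / 2 /\ b = 0) \/ (a = 0 /\ b = 1 / 2) & y <= 13 / 15 + t / 2] |
    c = 1 / 2 /\ vertex_excess a b c t y <= 11 / 5].
Proof.
move=> ha hb hc t0 tc q1 k10 k20 k30 D eq1 le3 le4 yE.
have [a0 av _] := ha; have [b0 bv _] := hb; have [c0 cv _] := hc.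
have y0 : 0 <= y.
  by rewrite yE addr_ge0 // mulr_ge0 ?sqr_ge0 // addr_ge0 // mulr_ge0 // addr_ge0 // mulr_ge0.
split=> //.
have half (x : R) : 0 <= x -> x = 0 \/ x = 1 / 2 \/ 1 / 2 <= x ^+ 2 -> x = 0 \/ 1 / 2 <= x.
  by move=> x0 [->|[->|h]]; [left|right|right; clear -x0 h; nra].
have [ce|c2] := half c c0 cv.
  constructor 1; rewrite ce in tc eq1 yE.
  have tE : t ^+ 2 = 1 by lra.
  rewrite tE in yE; have {}yE : y = k3 + (k1 * a + k2 * b) by rewrite yE; ring.
  have {}eq1 : q = k1 ^+ 2 + k2 ^+ 2 by move: eq1; rewrite expr0n /=; lra.
  have cs : (k1 * a + k2 * b) ^+ 2 <= (a ^+ 2 + b ^+ 2) * q.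
    rewrite eq1 -subr_ge0.
    have -> : (a ^+ 2 + b ^+ 2) * (k1 ^+ 2 + k2 ^+ 2) - (k1 * a + k2 * b) ^+ 2 = (a * k2 - b * k1) ^+ 2.
      by ring.
    exact: sqr_ge0.
  have L0 : 0 <= k3 * (k1 * a + k2 * b) by rewrite mulr_ge0 // addr_ge0 // mulr_ge0.
  have e2 : y ^+ 2 = k3 ^+ 2 + 2 * (k3 * (k1 * a + k2 * b)) + (k1 * a + k2 * b) ^+ 2 by rewrite yE; ring.
  (* The sum of [le3] and [le4] bounds the mixed term of [y^2], and altogether [y^2 <= q - k3^2]. *)
  by have := sqr_ge0 k3; clear -le3 le4 eq1 cs L0 e2 q1; lra.
have [a_0|a2] := half a a0 av; have [b_0|b2] := half b b0 bv.
- constructor 1; rewrite a_0 b_0 in yE le3.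
  have -> : y = k3 by rewrite yE; ring.
  by have := sqr_ge0 k1; clear -le3 q1; lra.
- have nb : b != 0 by apply/eqP; clear -b2; lra.
  have bc : b ^+ 2 + c ^+ 2 < 1 by rewrite a_0 in D; clear -D; lra.
  have eq1' : (1 - c ^+ 2) * q = k2 ^+ 2 + k1 ^+ 2 + 2 * c * k2 * k1 by rewrite eq1; ring.
  have yE' : y = k3 + t ^+ 2 * ((k2 + c * k1) * b) by rewrite yE a_0; ring.
  have [[be yle]|[ce yle]] := vertex_bound_side hb hc c2 t0 tc q1 k20 k10 k30 nb bc eq1' le4 yE'.
    by constructor 2; split=> //; right.
  by constructor 3; split=> //; rewrite /vertex_excess a_0; clear -yle; lra.
- have na : a != 0 by apply/eqP; clear -a2; lra.
  have ac : a ^+ 2 + c ^+ 2 < 1 by rewrite b_0 in D; clear -D; lra.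
  have yE' : y = k3 + t ^+ 2 * ((k1 + c * k2) * a) by rewrite yE b_0; ring.
  have [[ae yle]|[ce yle]] := vertex_bound_side ha hc c2 t0 tc q1 k10 k20 k30 na ac eq1 le3 yE'.
    by constructor 2; split=> //; left.
  by constructor 3; split=> //; rewrite /vertex_excess b_0; clear -yle; lra.
(* Three cosines of at least 1/2 would make the left side of [D] at least 3/4 + 1/4. *)
exfalso.
clear -a2 b2 c2 D.
have ab : 1 / 4 <= a * b by nra.
have abc : 1 / 8 <= a * b * c by nra.
have sq (x : R) : 1 / 2 <= x -> 1 / 4 <= x ^+ 2 by nra.
by have := sq a a2; have := sq b b2; have := sq c c2; lra.
Qed.

Lemma excess_T (a b c t y : R) : 0 <= a -> 0 <= b -> 0 <= c -> y ^+ 2 <= 1 -> vertex_excess a b c t y <= 1.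
Proof.
move=> a0 b0 c0 y1; rewrite /vertex_excess.
have : 0 <= (a ^+ 2 + b ^+ 2 + 2 * a * b * c) * t ^+ 2.
  by rewrite mulr_ge0 ?sqr_ge0 // !addr_ge0 ?sqr_ge0 // !mulr_ge0.
by lra.
Qed.

Lemma excess_H (a b c t y : R) : 0 <= y -> (a = 1 / 2 /\ b = 0) \/ (a = 0 /\ b = 1 / 2) ->
  y <= 13 / 15 + t / 2 -> 0 < t ->
  vertex_excess a b c t y <= 169 / 225 + 13 / 15 * t + t ^+ 2 / 8.
Proof.
move=> y0 h yle t0; rewrite /vertex_excess.
have -> : (a ^+ 2 + b ^+ 2 + 2 * a * b * c) = 1 / 4 by case: h => [[-> ->]|[-> ->]]; field.
have : y ^+ 2 <= (13 / 15 + t / 2) ^+ 2 by rewrite ler_sqr ?nnegrE //; lra.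
by clear; lra.
Qed.

(** The three alternatives bound the excess at a vertex by 1, 13/5 and 11/5, and by 11/5 also in the
    second one when [c = 1/2]. The mixed term may be dropped except when both vertices are of the
    second kind, as in [alpha0]. *)
Lemma total_bound (a b a' b' c t y y' : R) :
  angle_cos a -> angle_cos b -> angle_cos a' -> angle_cos b' -> angle_cos c ->
  0 < t -> t ^+ 2 * (1 - c ^+ 2) = 1 ->
  a ^+ 2 + b ^+ 2 + c ^+ 2 + 2 * a * b * c < 1 ->
  a' ^+ 2 + b' ^+ 2 + c ^+ 2 + 2 * a' * b' * c < 1 ->
  0 <= y -> 0 <= y' ->
  [\/ y ^+ 2 <= 1,
    [/\ 1 / 2 <= c, (a = 1 / 2 /\ b = 0) \/ (a = 0 /\ b = 1 / 2) & y <= 13 / 15 + t / 2] |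
    c = 1 / 2 /\ vertex_excess a b c t y <= 11 / 5] ->
  [\/ y' ^+ 2 <= 1,
    [/\ 1 / 2 <= c, (a' = 1 / 2 /\ b' = 0) \/ (a' = 0 /\ b' = 1 / 2) & y' <= 13 / 15 + t / 2] |
    c = 1 / 2 /\ vertex_excess a' b' c t y' <= 11 / 5] ->
  1 + vertex_excess a b c t y + vertex_excess a' b' c t y'
    - (a * a' + b * b' + c * (a * b' + b * a')) * t ^+ 2 <= 113 / 20.
Proof.
move=> [a0 _ _] [b0 _ _] [a'0 _ _] [b'0 _ _] [c0 _ cb] t0 tc D D' y0 y'0 h h'.
have X0 : 0 <= (a * a' + b * b' + c * (a * b' + b * a')) * t ^+ 2.
  by rewrite mulr_ge0 ?sqr_ge0 // !addr_ge0 ?mulr_ge0 // addr_ge0 ?mulr_ge0.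
(* A vertex of the second kind excludes [c^2 >= 3/4], hence [c <= 17/21]; the number 46/27 is
   slightly above the corresponding [t]. *)
have tb (x x' : R) : (x = 1 / 2 /\ x' = 0) \/ (x = 0 /\ x' = 1 / 2) ->
    x ^+ 2 + x' ^+ 2 + c ^+ 2 + 2 * x * x' * c < 1 -> t <= 46 / 27.
  move=> hx Dx; have c3 : c ^+ 2 < 3 / 4 by case: hx Dx => [[-> ->]|[-> ->]]; clear; lra.
  have c8 : c <= 17 / 21 by case: cb => //; clear -c3; lra.
  have c82 : c ^+ 2 <= 289 / 441 by clear -c8 c0; nra.
  have : t ^+ 2 * (152 / 441) <= 1 by rewrite -[leRHS]tc ler_wpM2l ?sqr_ge0 //; clear -c82; lra.
  by clear -t0; nra.
have t1 : c = 1 / 2 -> t <= 22 / 19.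
  move=> ce; rewrite ce in tc; have t2 : t ^+ 2 = 4 / 3 by lra.
  by clear -t2 t0; nra.
have H (x x' z : R) : (x = 1 / 2 /\ x' = 0) \/ (x = 0 /\ x' = 1 / 2) -> 0 <= z ->
    x ^+ 2 + x' ^+ 2 + c ^+ 2 + 2 * x * x' * c < 1 -> z <= 13 / 15 + t / 2 ->
    vertex_excess x x' c t z <= 13 / 5.
  move=> hx z0 Dx zle; have := excess_H c z0 hx zle t0; have tl := tb _ _ hx Dx.
  have : t ^+ 2 <= (46 / 27) ^+ 2 by rewrite ler_sqr ?nnegrE // ltW.
  by clear -tl; lra.
have H1 (x x' z : R) : c = 1 / 2 -> (x = 1 / 2 /\ x' = 0) \/ (x = 0 /\ x' = 1 / 2) -> 0 <= z ->
    z <= 13 / 15 + t / 2 -> vertex_excess x x' c t z <= 11 / 5.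
  move=> ce hx z0 zle; have := excess_H c z0 hx zle t0; have tl := t1 ce.
  have : t ^+ 2 <= (22 / 19) ^+ 2 by rewrite ler_sqr ?nnegrE // ltW.
  by clear -tl; lra.
case: h => [y1|[c2 hab yle]|[ce yle]]; case: h' => [y1'|[c2' hab' yle']|[ce' yle']].
- have h1 := excess_T t a0 b0 c0 y1; have h2 := excess_T t a'0 b'0 c0 y1'.
  by clear -X0 h1 h2; lra.
- have h1 := excess_T t a0 b0 c0 y1; have h2 := H _ _ _ hab' y'0 D' yle'.
  by clear -X0 h1 h2; lra.
- by have h1 := excess_T t a0 b0 c0 y1; clear -X0 h1 yle'; lra.
- have h1 := excess_T t a'0 b'0 c0 y1'; have h2 := H _ _ _ hab y0 D yle.
  by clear -X0 h1 h2; lra.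
- have h1 := excess_H c y0 hab yle t0; have h2 := excess_H c y'0 hab' yle' t0.
  have tl := tb _ _ hab D.
  have c1 : c <= 1.
    have : c ^+ 2 < 3 / 4 by case: hab D => [[-> ->]|[-> ->]]; clear; lra.
    by clear -c0; nra.
  (* Subtracting this part of the mixed term turns the two summands [t^2 / 8] into
     [t^2 (1 - c) / 4], which is at most 1/6 although [t] itself grows with [c]. *)
  have X : t ^+ 2 * c / 4 <= (a * a' + b * b' + c * (a * b' + b * a')) * t ^+ 2.
    have tt0 := sqr_ge0 t.
    have ct : t ^+ 2 * c <= t ^+ 2 by rewrite ler_piMr.
    by case: hab => [[-> ->]|[-> ->]]; case: hab' => [[-> ->]|[-> ->]]; clear -ct tt0 c0; lra.
  have tc1 : t ^+ 2 * (1 - c) <= 2 / 3.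
    have : t ^+ 2 * (1 - c) * (3 / 2) <= t ^+ 2 * (1 - c) * (1 + c).
      by apply: ler_wpM2l; [rewrite mulr_ge0 ?sqr_ge0 // subr_ge0|clear -c2; lra].
    by clear -tc; lra.
  by clear -X h1 h2 tc1 tl; lra.
- by have h1 := H1 _ _ _ ce' hab y0 yle; clear -X0 h1 yle'; lra.
- by have h1 := excess_T t a'0 b'0 c0 y1'; clear -X0 h1 yle; lra.
- by have h1 := H1 _ _ _ ce hab' y'0 yle'; clear -X0 h1 yle; lra.
- by clear -X0 yle yle'; lra.
Qed.

(** Maximality of the chosen edge, divided by [N^2] and written in terms of the cosine [-g]. *)
Lemma scaled_line_bound (x z g q N2 : R) : 0 < N2 -> g ^+ 2 < 1 ->
  (x ^+ 2 + z ^+ 2 - 2 * g * x * z) / (1 - g ^+ 2) <= q ->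
  forall N, N ^+ 2 = N2 -> 0 < N ->
  (- x / N) ^+ 2 + (- z / N) ^+ 2 + 2 * (- g) * (- x / N) * (- z / N) <= (1 - (- g) ^+ 2) * (q / N2).
Proof.
move=> N20 g1 h N NE N0; rewrite ler_pdivrMr ?subr_gt0 // in h.
have -> : (- x / N) ^+ 2 + (- z / N) ^+ 2 + 2 * (- g) * (- x / N) * (- z / N) =
    (x ^+ 2 + z ^+ 2 - 2 * g * x * z) / N2.
  by rewrite -NE; field; rewrite gt_eqF.
by rewrite mulrA ler_pM2r ?invr_gt0 // sqrrN [leRHS]mulrC.
Qed.

Lemma coxeter_narrow_ridge (P : set vec) : compact_coxeter_polytope P ->
  exists E V1 V2 F1 F2 F3 F4 t, ridge P E V1 V2 F1 F2 F3 F4 t /\ width F3 F4 <= 113 / 20.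
Proof.
move=> hP; have [cox cP] := hP.
have [n [e [ O [PE sys ac [i0 [j0 [ij0 g0]]]]]]] := coxeter_acute hP.
rewrite {}PE {P hP} in cox cP *; have [e1 hO Oe] := sys.
have [|[i j] /= /andP[ij g1] ijmax] := @exists_argmax ('I_n * 'I_n)%type
  (fun z => (z.1 != z.2) && (lor (e z.1) (e z.2) ^+ 2 < 1))
  (fun z => sinh2_line O (e z.1) (e z.2)) (i0, j0); first by rewrite /= ij0.
have [k [l [V1 [V2 [un [gik gjk gil gjl] rid [p [u [N fr]]]]]]]] := ridge_at sys ac cP ij g1.
have [[hp uu up [pi pj]] [ui uj] [/andP[ul pl] /andP[pk uk]] [N0 N2] hN] := fr.
have [ik jk il jl kl] : [/\ i != k, j != k, i != l, j != l & k != l].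
  by move: un; rewrite /= !inE !negb_or => /and4P[/and3P[_ -> ->] /andP[-> ->] -> _].
exists (wall (cell e) (e i) `&` wall (cell e) (e j)), V1, V2, (wall (cell e) (e i)),
  (wall (cell e) (e j)), (wall (cell e) (e k)), (wall (cell e) (e l)).
eexists; split; first exact: rid.
apply: le_trans (width_wall sys ac cP kl) _; rewrite ge_max; apply/andP; split; first by lra.
have fg := frame_gram hp uu up pi pj ui uj (e1 i) (e1 j) g1.
have ang x y : x != y -> lor (e x) (e y) ^+ 2 < 1 -> angle_cos (- lor (e x) (e y)).
  move=> xy gxy; have [m m2 ->] := acute_gram sys ac cP cox xy gxy.
  by rewrite opprK; exact: angle_cos_pi.
have sle x y : x != y -> lor (e x) (e y) ^+ 2 < 1 ->
    sinh2_line O (e x) (e y) <= sinh2_line O (e i) (e j).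
  by move=> xy gxy; apply: (ijmax (x, y)); rewrite /= xy.
have N20 : 0 < N ^+ 2 by rewrite exprn_gt0.
have bnd x y (xy : x != y) (gxy : lor (e x) (e y) ^+ 2 < 1) :=
  scaled_line_bound N20 gxy (sle x y xy gxy) erefl N0.
set q := sinh2_line O (e i) (e j) in N2 sle bnd.
have q1 : q / N ^+ 2 <= 1 by rewrite ler_pdivrMr // N2; lra.
pose c := - lor (e i) (e j).
have D0 : 0 < 1 - c ^+ 2 by rewrite /c sqrrN subr_gt0.
pose t := (Num.sqrt (1 - c ^+ 2))^-1.
have t0 : 0 < t by rewrite invr_gt0 sqrtr_gt0.
have t2 : t ^+ 2 = (1 - c ^+ 2)^-1 by rewrite exprVn sqr_sqrtr // ltW.
have tc : t ^+ 2 * (1 - c ^+ 2) = 1 by rewrite t2 mulVf ?gt_eqF.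
have K0 x : 0 <= - lor O (e x) / N by rewrite divr_ge0 ?oppr_ge0 ?ltW.
have eq1 : (1 - c ^+ 2) * (q / N ^+ 2) = (- lor O (e i) / N) ^+ 2 + (- lor O (e j) / N) ^+ 2 +
    2 * c * (- lor O (e i) / N) * (- lor O (e j) / N).
  by rewrite /q /sinh2_line /c; field; rewrite !gt_eqF ?subr_gt0.
have yE m : - lor p (e m) = - lor O (e m) / N + t ^+ 2 *
    ((- lor O (e i) / N + c * (- lor O (e j) / N)) * - lor (e i) (e m) +
     (- lor O (e j) / N + c * (- lor O (e i) / N)) * - lor (e j) (e m)).
  have -> : lor p (e m) = (N * lor p (e m)) / N by field; rewrite gt_eqF.
  rewrite hN t2 /line_coef (lorC (e j) (e i)) /c; field.
  by rewrite !gt_eqF ?subr_gt0 ?sqrrN ?subr_gt0.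
(* The squared length of the component of [e m] in the span of [e i] and [e j]; the identity [sE]
   then says that [e m] is a unit vector. *)
pose U m := ((- lor (e i) (e m)) ^+ 2 + (- lor (e j) (e m)) ^+ 2 +
  2 * - lor (e i) (e m) * - lor (e j) (e m) * c) * t ^+ 2.
have sE m : lor u (e m) ^+ 2 = 1 + (- lor p (e m)) ^+ 2 - U m.
  have := fg (e m) (e m); rewrite e1 /U t2 /c [(- lor (e i) (e j)) ^+ 2]sqrrN.
  by set D := (1 - _)^-1 => E; clear -E; lra.
(* The line leaves the cell before its ideal point, which amounts to [U m < 1], the positivity of
   the Gram determinant at the vertex. *)
have DE m : lor p (e m) ^+ 2 < lor u (e m) ^+ 2 ->
    (- lor (e i) (e m)) ^+ 2 + (- lor (e j) (e m)) ^+ 2 + c ^+ 2 +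
    2 * - lor (e i) (e m) * - lor (e j) (e m) * c < 1.
  rewrite sE sqrrN /U => h.
  have : ((- lor (e i) (e m)) ^+ 2 + (- lor (e j) (e m)) ^+ 2 +
    2 * - lor (e i) (e m) * - lor (e j) (e m) * c) * t ^+ 2 < 1 by clear -h; lra.
  by rewrite t2 ltr_pdivrMr // mul1r; clear; lra.
have Dk := DE k ltac:(clear -pk uk; nra); have Dl := DE l ltac:(clear -ul pl; nra).
have [yk vk] := vertex_bound (ang _ _ ik gik) (ang _ _ jk gjk) (ang _ _ ij g1) t0 tc q1
  (K0 i) (K0 j) (K0 k) Dk eq1 (bnd _ _ ik gik) (bnd _ _ jk gjk) (yE k).
have [yl vl] := vertex_bound (ang _ _ il gil) (ang _ _ jl gjl) (ang _ _ ij g1) t0 tc q1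
  (K0 i) (K0 j) (K0 l) Dl eq1 (bnd _ _ il gil) (bnd _ _ jl gjl) (yE l).
have := total_bound (ang _ _ ik gik) (ang _ _ jk gjk) (ang _ _ il gil) (ang _ _ jl gjl)
  (ang _ _ ij g1) t0 tc Dk Dl yk yl vk vl.
apply: le_trans; rewrite /vertex_excess -/c.
have skE := sE k; have slE := sE l; rewrite /U in skE slE.
(* These squares are the two AM-GM steps, for the components along [p] and along [u]. *)
have h1 := sqr_ge0 (lor p (e k) - lor p (e l)).
have h2 := sqr_ge0 (lor u (e k) + lor u (e l)).
have -> : - lor (e k) (e l) = lor p (e k) * lor p (e l) - lor u (e k) * lor u (e l) -
   (- lor (e i) (e k) * - lor (e i) (e l) + - lor (e j) (e k) * - lor (e j) (e l) +
    c * (- lor (e i) (e k) * - lor (e j) (e l) + - lor (e j) (e k) * - lor (e i) (e l))) * t ^+ 2.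
  by rewrite (fg (e k) (e l)) t2 /c [(- lor (e i) (e j)) ^+ 2]sqrrN; field; rewrite gt_eqF ?subr_gt0.
by rewrite !sqrrN in skE slE *; clearbody t c; clear -skE slE h1 h2; lra.
Qed.

(** * The simplex [5,3^{1,1}] *)

(** The radius is the distance from [O] to the plane, with hyperbolic sine [-h]. Cauchy-Schwarz is
    applied to the components of [y] and [e] orthogonal to [O]. *)
Lemma halfspace_ball O e : H3 O -> lor e e = 1 -> lor O e < 0 ->
  exists2 r, 0 < r & forall y, H3 y -> hdist O y < r -> lor y e <= 0.
Proof.
move=> hO ee Oe; set h := lor O e in Oe *.
have w1 : 1 < Num.sqrt (1 + h ^+ 2).
  rewrite -[X in X < _]sqrtr1 ltr_sqrt; last by have := sqr_ge0 h; lra.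
  by rewrite ltrDl exprn_even_gt0 //= lt_eqF.
have w2 : Num.sqrt (1 + h ^+ 2) ^+ 2 = 1 + h ^+ 2.
  by rewrite sqr_sqrtr // addr_ge0 ?sqr_ge0.
exists (acosh (Num.sqrt (1 + h ^+ 2))).
  rewrite /acosh ln_gt0 //; apply: lt_le_trans w1 _; by rewrite lerDl sqrtr_ge0.
move=> y hy; rewrite /hdist => hd; rewrite leNgt; apply/negP => ye.
have a1 := H3_lor_leN1 hO hy.
have aw : - lor O y < Num.sqrt (1 + h ^+ 2).
  rewrite ltNge; apply/negP => wa; move: hd; rewrite ltNge acosh_le //; exact: ltW.
have := @lor_perp_cs O (y + lor O y *: O) (e + h *: O) (H3_lor_lt0_self hO).
rewrite !lorE (proj1 hO) (proj1 hy) ee (lorC y O) (lorC e O) -/h.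
have -> : lor O y + lor O y * -1 = 0 by ring.
have -> : h + h * -1 = 0 by ring.
move=> /(_ erefl erefl).
move: aw a1 ye; set a := lor O y; set m := lor y e => aw a1 ye hcs.
have a2 : a ^+ 2 < 1 + h ^+ 2.
  by rewrite -w2 -sqrrN ltr_sqr ?nnegrE //; lra.
have : (m + h * a) ^+ 2 <= (a ^+ 2 - 1) * (1 + h ^+ 2) by move: hcs; lra.
have : (h * a) ^+ 2 < (m + h * a) ^+ 2.
  by rewrite ltr_sqr ?nnegrE; [lra|rewrite nmulr_rge0 //; lra|rewrite addr_ge0 ?(ltW ye) // nmulr_rge0 //; lra].
by rewrite exprMn; lra.
Qed.

Lemma system_convex n (e : 'I_n -> vec) O : system e O -> convex_polytope (cell e).
Proof.
move=> [e1 hO Oe]; split; first by exists n, e; split=> // i; rewrite e1.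
exists O; split; first by split=> // i; exact: ltW.
have [|r r0 hr] := @small_forall n (fun i t => forall y, H3 y -> hdist O y < t -> lor y (e i) <= 0).
  move=> i; have [r r0 hr] := halfspace_ball hO (e1 i) (Oe i).
  by exists r => // t /andP[_ tr] y hy yt; apply: hr => //; exact: lt_le_trans tr.
exists r; split=> // y hy yr; split=> // i; apply: (hr r) => //; by rewrite r0 lexx.
Qed.

Lemma orth3_collinear (x : 'I_3 -> vec) e f : row_free (\matrix_(i < 3) x i) ->
  lor e e = 1 -> (forall i, lor (x i) e = 0) -> (forall i, lor (x i) f = 0) ->
  f = lor f e *: e.
Proof.
move=> rx ee xe xf; apply/eqP; rewrite -subr_eq0; apply/negP => /negP r0.
set r := f - _ in r0.
have re : lor r e = 0 by rewrite /r !lorE ee; ring.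
have xr i : lor (x i) r = 0 by rewrite /r !lorE xe xf; ring.
clearbody r.
suff : (3 + 2 <= 4)%N by [].
apply: (@indep_orth 3 2 x (fun i => if i == 0 :> nat then e else r) rx); last first.
  by move=> i j; case: ifP.
apply: row_freeE => d; rewrite mulmx_sum_row !big_ord_recl big_ord0 addr0 !rowK /=.
set d0 := d _ _; set d1 := d _ _ => h.
have d0E : d0 = 0.
  by have := congr1 (fun z => lor z e) h; rewrite /= !lorE ee re; lra.
have d1E : d1 = 0.
  by move/eqP: h; rewrite d0E scale0r add0r scaler_eq0 (negbTE r0) orbF => /eqP.
by apply/rowP => i; rewrite mxE; case: (unliftP ord0 i) => [j ->|-> //]; rewrite (ord1 j).
Qed.

(** A facet comes with an arbitrary supporting vector [f0]. If no wall contained its three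
    independent points, their sum [S] would be strictly inside all half-spaces, and a small move
    along [f0] would stay in the cell while violating the inequality of [f0]. *)
Lemma facet_is_wall n (e : 'I_n -> vec) O F : system e O -> facet (cell e) F ->
  exists i, F = wall (cell e) (e i) /\ forall f, outward_normal (cell e) F f -> f = e i.
Proof.
move=> [e1 hO Oe] [[f0 [f00 [hf0 [FE _]]]] [[x [xF rx]] _]].
have cO : cell e O by split=> // i; exact/ltW.
have xP i : cell e (x i) by have := xF i; rewrite FE => -[].
have xf0 i : lor (x i) f0 = 0 by have := xF i; rewrite FE => -[].
have [i xi] : exists i, forall k, lor (x k) (e i) = 0.
  apply: contrapT => h.
  pose S := \sum_k x k.
  have SE z : lor S z = \sum_k lor (x k) z.
    by rewrite /S; elim/big_rec2: _ => [|k a b _ <-]; rewrite ?lor0l ?lorDl.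
  have Si i : lor S (e i) < 0.
    rewrite SE; have [k xk] : exists k, lor (x k) (e i) < 0.
      apply: contrapT => h'; apply: h; exists i => k; apply/eqP; rewrite eq_le (proj2 (xP k)) /=.
      by rewrite leNgt; apply/negP => hk; apply: h'; exists k.
    rewrite (bigD1 k) //=; have : \sum_(j < 3 | j != k) lor (x j) (e i) <= 0.
      by apply: sumr_le0 => j _; exact: (proj2 (xP j)).
    by lra.
  have SO : lor S O < 0.
    rewrite SE (bigD1 ord0) //=.
    have := H3_lor_lt0 (proj1 (xP ord0)) hO.
    have : \sum_(j < 3 | j != ord0) lor (x j) O <= 0.
      by apply: sumr_le0 => j _; apply/ltW/H3_lor_lt0 => //; exact: (proj1 (xP j)).
    by lra.
  have SS : lor S S < 0.
    have Sx k : lor S (x k) < 0.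
      rewrite SE (bigD1 k) //=.
      have := H3_lor_lt0 (proj1 (xP k)) (proj1 (xP k)).
      have : \sum_(j < 3 | j != k) lor (x j) (x k) <= 0.
        by apply: sumr_le0 => j _; apply/ltW/H3_lor_lt0; exact: (proj1 (xP _)).
      by lra.
    rewrite SE (bigD1 ord0) //=; have := Sx ord0; rewrite lorC.
    have : \sum_(j < 3 | j != ord0) lor (x j) S <= 0.
      by apply: sumr_le0 => j _; rewrite lorC; exact: ltW.
    by lra.
  have Sf : lor S f0 = 0 by rewrite SE big1.
  have fS := future_inv (H3_future hO) SS SO.
  have [c c0 hc] := hnorm_scale SS.
  clearbody S.
  have [|d d0 /(_ d)] := @cell_nbhd n e (hnorm S) f0 (hnorm_H3 fS).
    by move=> i; left; rewrite hc lorE pmulr_rlt0.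
  rewrite d0 lexx => /(_ isT)[ff fc].
  have := hf0 _ (cell_hnorm ff fc); have [c' c'0 ->] := hnorm_scale (proj1 ff).
  rewrite hc !lorE Sf mulr0 add0r leNgt; apply/negP/negPn.
  by rewrite !mulr_gt0.
have col f : (forall k, lor (x k) f = 0) -> f = lor f (e i) *: e i.
  exact: (orth3_collinear rx (e1 i) xi).
exists i; split.
  have f0E := col f0 xf0; have l0 : lor f0 (e i) != 0.
    by apply: contraTneq f00 => l0; rewrite f0E l0 scale0r lor0l ltxx.
  have yf y : (lor y f0 == 0) = (lor y (e i) == 0).
    by rewrite f0E lorE mulf_eq0 (negbTE l0).
  by rewrite FE; apply/seteqP; split=> y [Py /eqP h]; split=> //; apply/eqP; rewrite ?yf // -yf.
(* Two unit normals to the same three points agree up to sign, and [O] fixes the sign. *)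
move=> f [ff [hf FE']].
have fE : f = lor f (e i) *: e i by apply: col => k; have := xF k; rewrite FE' => -[].
set l := lor f (e i) in fE.
have l2 : l ^+ 2 = 1 by move: ff; rewrite fE !lorE e1; lra.
have lO := hf O cO; rewrite fE lorE in lO.
have l0 : 0 <= l by have := Oe i; nra.
have l1 : l = 1 by nra.
by rewrite fE l1 scale1r.
Qed.

Lemma acos_cos_pi (k : nat) : (2 <= k)%N -> acos (cos ((pi : R) / k%:R)) = pi / k%:R.
Proof.
move=> /angle_bounds /andP[h1 h2]; apply: cosK; rewrite in_itv /= h1 /=.
by apply: le_trans h2 _; rewrite ler_pdivrMr // ler_peMr ?pi_ge0 // ler1n.
Qed.

Lemma gram_coxeter n (e : 'I_n -> vec) O : system e O ->
  (forall i j, i != j -> exists2 k : nat, (2 <= k)%N & lor (e i) (e j) = - cos (pi / k%:R)) ->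
  coxeter_polytope (cell e).
Proof.
move=> sys hk; split; first exact: system_convex sys.
move=> F G hF hG FG _ a [f [g [nf [ng ->]]]].
have [i [FE /(_ _ nf) ->]] := facet_is_wall sys hF.
have [j [GE /(_ _ ng) ->]] := facet_is_wall sys hG.
have ij : i != j by apply/eqP => ij; apply: FG; rewrite FE GE ij.
have [k k2 ->] := hk i j ij; exists k; split=> //.
by rewrite opprK acos_cos_pi.
Qed.

Lemma lor_continuous (f : vec -> vec) : (forall i, continuous (fun x => f x ord0 i)) ->
  continuous (fun x : vec => lor x (f x)).
Proof.
move=> hf; rewrite (funext (fun x => lor_coord x (f x))) => x.
have h i : {for x, continuous (fun y : vec => y ord0 i * f y ord0 i)}.
  by apply: continuousM; [exact: coord_continuous|exact: hf].
exact: (continuousD (continuousN (h ord0))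
  (continuousD (continuousD (h (lift ord0 ax0)) (h (lift ord0 ax1))) (h (lift ord0 ax2)))).
Qed.

Lemma cell_closed n (e : 'I_n -> vec) : closed (cell e).
Proof.
(* The strict inequality on coordinate 0 may be relaxed to a closed one, because [lor x x = -1]
   excludes the value 0. *)
have -> : cell e = (fun x => lor x x) @^-1` [set t | t = -1] `&`
    (fun x => x ord0 ord0) @^-1` [set t | 0 <= t] `&`
    \bigcap_i ((fun x => lor x (e i)) @^-1` [set t | t <= 0]).
  apply/seteqP; split=> x /=.
    by move=> [[xx x0] hx]; split; [split=> //; exact: ltW|move=> i _; exact: hx].
  move=> [[xx x0] hx]; split; last by move=> i; exact: hx.
  split=> //; rewrite lt_neqAle x0 andbT; apply/eqP => z0; move: xx; rewrite lor_coord -z0.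
  have := sqr_ge0 (sp x ax0); have := sqr_ge0 (sp x ax1); have := sqr_ge0 (sp x ax2).
  by lra.
apply: closedI; first apply: closedI.
- apply: preimage_closed; last exact: closed_eq.
  move=> x _; apply: lor_continuous => i; exact: (@coord_continuous R 1 4 ord0 i).
- by apply: preimage_closed; [move=> x _; exact: (@coord_continuous R 1 4 ord0 ord0)|exact: closed_ge].
apply: closed_bigI => i _; apply: preimage_closed; last exact: closed_le.
by move=> x _; apply: lor_continuous => j; exact: cst_continuous.
Qed.

Lemma bounded_coord (A : set vec) M : (forall x, A x -> forall i, `|x ord0 i| <= M) -> bounded_set A.
Proof.
move=> h; exists (Num.max M 0); split; first exact: num_real.
move=> K hK x Ax /=; rewrite /Num.Def.normr /= mx_normrE.
apply: bigmax_le => [|[i j] _ /=].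
  by apply: le_trans (ltW hK); rewrite le_max lexx orbT.
rewrite (ord1 i); apply: le_trans (h x Ax j) _; apply: le_trans (ltW hK).
by rewrite le_max lexx.
Qed.

(* The normals of the simplex with Coxeter diagram [5,3^{1,1}]: [e_0] is the node of valence three. *)
Definition star_vec : vec :=
  \row_(j < 4) nth 0 [:: Num.sqrt (cos (pi / 5) ^+ 2 - 1 / 2); - cos (pi / 5); - (1 / 2); - (1 / 2)] j.

(** The other three nodes are spatial coordinate vectors, hence mutually orthogonal; the time
    coordinate of [star_vec] is the one giving it square 1. *)
Definition star (i : 'I_4) : vec := if i == ord0 then star_vec else delta_mx ord0 i.

Lemma cos_pi5_bounds : 4 / 5 <= cos ((pi : R) / 5) <= 17 / 21.
Proof. by have := cos_pi5; have := cos_pi_gt0 (isT : (2 < 5)%N) => ? ?; apply/andP; split; nra. Qed.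

Lemma lor_delta (x : vec) (i : 'I_3) : lor x (delta_mx ord0 (lift ord0 i)) = sp x i.
Proof.
rewrite /lor (bigD1 (lift ord0 i)) //= big1 => [|j ji].
  by rewrite addr0 mxE !eqxx mulr1 mul1r.
by rewrite mxE (negbTE ji) andbF mulr0.
Qed.

Lemma star_lift i : star (lift ord0 i) = delta_mx ord0 (lift ord0 i).
Proof. by rewrite /star eq_sym (negbTE (neq_lift _ _)). Qed.

Lemma sp_star_vec (i : 'I_3) : sp star_vec i = - cos (pi / (if i == 0 :> nat then 5 else 3)%:R).
Proof.
rewrite /sp mxE; case: i => [[|[|[|//]]] hi] //=; by rewrite cos_pi3.
Qed.

Lemma star_gram0 i : lor (star ord0) (star (lift ord0 i)) =
  - cos (pi / (if i == 0 :> nat then 5 else 3)%:R).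
Proof. by rewrite star_lift lor_delta -sp_star_vec. Qed.

Lemma star_gram_lift i j : lor (star (lift ord0 i)) (star (lift ord0 j)) = (i == j)%:R.
Proof.
by rewrite !star_lift lor_delta /sp mxE eqxx (inj_eq lift_inj) eq_sym.
Qed.

Lemma star_unit i : lor (star i) (star i) = 1.
Proof.
case: (unliftP ord0 i) => [j ->|->]; first by rewrite star_gram_lift eqxx.
have /andP[c1 _] := cos_pi5_bounds.
have s2 : 0 <= cos (pi / 5) ^+ 2 - 1 / 2 :> R by nra.
rewrite /star eqxx lor_coord !sp_star_vec cos_pi3 /= mxE /=.
by rewrite -expr2 sqr_sqrtr //; field.
Qed.

Lemma star_gram i j : i != j -> exists2 k : nat, (2 <= k)%N & lor (star i) (star j) = - cos (pi / k%:R).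
Proof.
case: (unliftP ord0 i) => [i' ->|->]; case: (unliftP ord0 j) => [j' ->|->] //= ij.
- exists 2%N; rewrite // star_gram_lift (inj_eq lift_inj) in ij *.
  by rewrite (negbTE ij) cos_pihalf oppr0.
- by exists (if i' == 0 :> nat then 5 else 3)%N; [case: ifP|rewrite lorC star_gram0].
- by exists (if j' == 0 :> nat then 5 else 3)%N; [case: ifP|rewrite star_gram0].
Qed.

Lemma star_acute : acute star.
Proof. by move=> i j /star_gram[k k2 ->]; rewrite oppr_le0 coxeter_gram_le0. Qed.

(** Small negative spatial coordinates satisfy the three coordinate inequalities, and the time
    coordinate dominates in the product with [star_vec]. *)
Definition star_center : vec := \row_(j < 4) (if j == ord0 then 1 else - (1 / 10)).

Lemma star_system : system star (hnorm star_center).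
Proof.
have c0 : star_center ord0 ord0 = 1 by rewrite mxE eqxx.
have cs i : sp star_center i = - (1 / 10).
  by rewrite /sp mxE eq_sym (negbTE (neq_lift _ _)).
have cc : lor star_center star_center < 0 by rewrite lor_coord c0 !cs; lra.
split; first exact: star_unit.
  by apply: hnorm_H3; split; rewrite // c0 ltr01.
move=> i; have [d d0 ->] := hnorm_scale cc; rewrite lorE pmulr_rlt0 //.
case: (unliftP ord0 i) => [j ->|->]; first by rewrite star_lift lor_delta cs; lra.
have /andP[c1 c2] := cos_pi5_bounds.
rewrite /star eqxx lor_coord !cs c0 !sp_star_vec cos_pi3 /= mxE /=.
have : 3 / 10 < Num.sqrt (cos (pi / 5) ^+ 2 - 1 / 2 : R).
  rewrite -[X in X < _]ger0_norm -?sqrtr_sqr; last by lra.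
  rewrite ltr_sqrt; first by nra.
  by nra.
by lra.
Qed.

Lemma star_compact : compact (cell star).
Proof.
apply: bounded_closed_compact; last exact: cell_closed.
apply: (@bounded_coord _ 2) => x [[xx x0] hx].
have h i : sp x i <= 0 by rewrite -lor_delta -star_lift.
have h0 := hx ord0; have /andP[c1 c2] := cos_pi5_bounds.
have s2 : Num.sqrt (cos (pi / 5) ^+ 2 - 1 / 2 : R) ^+ 2 <= 4 / 25.
  by rewrite sqr_sqrtr; nra.
move: h0 s2 (sqrtr_ge0 (cos (pi / 5) ^+ 2 - 1 / 2 : R)).
rewrite /star eqxx lor_coord !sp_star_vec cos_pi3 /= mxE /=.
move: (h ax0) (h ax1) (h ax2) xx; rewrite lor_coord.
set X := sp x ax0; set Y := sp x ax1; set Z := sp x ax2; set T := x ord0 ord0 in x0 *.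
set s := Num.sqrt _; set c := cos _ in c1 c2 * => X0 Y0 Z0 xx hs s2 s0.
(* With [T^2 = 1 + X^2 + Y^2 + Z^2] and [X], [Y], [Z] of one sign, squaring bounds a quarter of
   [X^2 + Y^2 + Z^2] by 4/25 of [T^2]; hence the bound 16/9. *)
have M1 : (- X - Y - Z) / 2 <= s * T by clear -hs c1 X0; nra.
have M2 : ((- X - Y - Z) / 2) ^+ 2 <= (s * T) ^+ 2.
  by rewrite ler_sqr ?nnegrE //; clear -X0 Y0 Z0 s0 x0; [lra|rewrite mulr_ge0 // ltW].
have XY : 0 <= X * Y by rewrite mulr_le0.
have YZ : 0 <= Y * Z by rewrite mulr_le0.
have XZ : 0 <= X * Z by rewrite mulr_le0.
have sT : (s * T) ^+ 2 <= 4 / 25 * T ^+ 2 by rewrite exprMn ler_wpM2r ?sqr_ge0.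
have [X2 Y2 Z2] : [/\ 0 <= X ^+ 2, 0 <= Y ^+ 2 & 0 <= Z ^+ 2] by rewrite !sqr_ge0.
have rho : X ^+ 2 + Y ^+ 2 + Z ^+ 2 <= 16 / 9 by clear -M2 XY YZ XZ sT xx; lra.
have sq (z : R) : z ^+ 2 <= 4 -> `|z| <= 2.
  by move=> z2; rewrite ler_norml; apply/andP; split; clear -z2; nra.
move=> i; apply: sq; case: (unliftP ord0 i) => [j ->|->]; last by rewrite -/T; clear -xx rho; lra.
have -> : x ord0 (lift ord0 j) = sp x j by [].
case: j => [[|[|[|//]]] hj].
- by rewrite (_ : sp x _ = X); [lra|congr sp; exact: val_inj].
- by rewrite (_ : sp x _ = Y); [lra|congr sp; exact: val_inj].
- by rewrite (_ : sp x _ = Z); [lra|congr sp; exact: val_inj].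
Qed.

(** The edge is that of node 0 and its neighbour at angle [pi / 5]. The framing facets are then the
    two remaining nodes, and their order is immaterial because both have the same products with the
    first two. *)
Lemma Omega_alpha0 : Omega alpha0.
Proof.
have g1 i : lor (star ord0) (star (lift ord0 i)) ^+ 2 < 1.
  have /andP[c1 c2] := cos_pi5_bounds.
  by rewrite star_gram0 sqrrN; case: ifP => _; rewrite ?cos_pi3; nra.
have o1 : (ord0 : 'I_4) != lift ord0 ax0 by rewrite neq_lift.
have [k [l [V1 [V2 [un _ rid _]]]]] := ridge_at star_system star_acute star_compact o1 (g1 ax0).
exists (cell star); do 7 eexists; split.
  by split; [exact: gram_coxeter star_system star_gram|exact: star_compact].
have gram1 m : m \notin [:: ord0; lift ord0 ax0] ->
    lor (star ord0) (star m) = - cos (pi / 3%:R) /\ lor (star (lift ord0 ax0)) (star m) = 0.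
  rewrite !inE negb_or; case: (unliftP ord0 m) => [j ->|->] // /andP[_].
  rewrite (inj_eq lift_inj) => j0; rewrite star_gram0 star_gram_lift [ax0 == j]eq_sym (negbTE j0); split=> //.
  by case: ifP j0 => // /eqP h /negP[]; apply/eqP/val_inj.
move: un; rewrite cons_uniq cons_uniq => /and3P[h1 h2 _].
have [k1 k2] : lor (star ord0) (star k) = - cos (pi / 3%:R) /\ lor (star (lift ord0 ax0)) (star k) = 0.
  by apply: gram1; move: h1 h2; rewrite !inE !negb_or !(eq_sym k) => /and3P[_ -> _] /andP[-> _].
have [l1 l2] : lor (star ord0) (star l) = - cos (pi / 3%:R) /\ lor (star (lift ord0 ax0)) (star l) = 0.
  by apply: gram1; move: h1 h2; rewrite !inE !negb_or !(eq_sym l) => /and3P[_ _ ->] /andP[_ ->].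
move: rid; rewrite k1 k2 l1 l2 star_gram0 /= !opprK oppr0 !acos_cos_pi // -[0]cos_pihalf.
by rewrite (acos_cos_pi (isT : (2 <= 2)%N)); exact.
Qed.

Theorem theoremA :
  exists tt : rtype -> R,
    (forall P : set vec, compact_coxeter_polytope P ->
       exists E V1 V2 F1 F2 F3 F4 (t : rtype),
         ridge P E V1 V2 F1 F2 F3 F4 t /\ width F3 F4 < tt t) /\
    Omega alpha0 /\
    (forall t, Omega t -> tt t <= tt alpha0) /\
    tt alpha0 < 575%:R / 100%:R.
Proof.
(* Any constant strictly between 113/20 and 5.75 would do. *)
exists (fun=> 57 / 10); split; last by split; [exact: Omega_alpha0|split=> //; lra].
move=> P /coxeter_narrow_ridge[E [V1 [V2 [F1 [F2 [F3 [F4 [t [rid w]]]]]]]]].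
by exists E, V1, V2, F1, F2, F3, F4, t; split=> //; apply: le_lt_trans w _; lra.
Qed.
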